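(* Let $K/k$ be a separable field extension of degree $6$ and let $\widetilde{K}/k$ be its Galois closure. Assume that $\operatorname{Gal}(\widetilde{K}/k)=F_{36}:2$ and consider fields $F$ with $K\subset F\subset\widetilde{K}$. (a) If $[F:k]=12$, then $F/k$ is not Hopf Galois. (b) If $[F:k]=18$, then $F/k$ is Hopf Galois but not almost classically Galois. (c) If $[F:k]=24$, then $F/k$ is not Hopf Galois. (d) There exist such fields $F$ with $[F:k]=36$ such that $F/k$ is almost classically Galois. More explicitly, this is so if $\operatorname{Gal}(\widetilde{K}/F)$ is generated by a transposition in $S_6$.
   Context: $F_{36}:2$ denotes the transitive permutation group $6T13$ of degree $6$ and order $72$; abstractly it is isomorphic to the wreath product $S_3\wr C_2$. The Galois group $G=\operatorname{Gal}(\widetilde{K}/k)$ is viewed as a transitive subgroup of $S_6$ via left translation on the six left cosets $G/\operatorname{Gal}(\widetilde{K}/K)$. A finite extension of fields $L/k$ is called Hopf Galois if there exists a finite cocommutative $k$-Hopf algebra $H$ such that $L$ is an $H$-module algebra and the $k$-linear map $j: L\otimes_k H\to \operatorname{End}_k(L)$, $j(s\otimes h)(t)=s(ht)$ for $h\in H$, $s,t\in L$, is bijective. Let $L/k$ be a finite separable extension with Galois closure $\widetilde{L}/k$, $\Gamma=\operatorname{Gal}(\widetilde{L}/k)$, $\Gamma'=\operatorname{Gal}(\widetilde{L}/L)$, and let $\lambda:\Gamma\to\operatorname{Sym}(\Gamma/\Gamma')$ be the left translation action on left cosets. $L/k$ is called almost classically Galois if there is a regular (i.e. sharply transitive) subgroup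 $N$ of $\operatorname{Sym}(\Gamma/\Gamma')$ which is normalized by $\lambda(\Gamma)$ and contained in $\lambda(\Gamma)$; equivalently, $\Gamma'$ has a normal complement in $\Gamma$. *)

(* Defs.v *)
From HB Require Import structures.
From mathcomp Require Import all_boot all_order all_algebra all_fingroup.
From mathcomp Require Import all_solvable all_field.

Set Implicit Arguments.
Unset Strict Implicit.
Unset Printing Implicit Defensive.

Import GRing.Theory.
Local Open Scope ring_scope.

(* V (x) W is modelled by the space of matrices of coordinates in the
   canonical bases of V and W. *)
Notation tens V W := 'M_(\dim {: V}, \dim {: W}).

Section Tensor.
Variables (k : fieldType) (V W : vectType k).

Definition ptens (v : V) (w : W) : tens V W :=
  \matrix_(i, j) (coord (vbasis {: V}) i v * coord (vbasis {: W}) j w).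

(* The linear map on V (x) W induced by b : V -> W -> U, which is meant to be
   bilinear. In Sweedler notation, tlift b t is "\sum b t_(1) t_(2)". *)
Definition tlift (U : lmodType k) (b : V -> W -> U) (t : tens V W) : U :=
  \sum_i \sum_j t i j *: b (vbasis {: V})`_i (vbasis {: W})`_j.

Lemma tlift_ptens (U : lmodType k) (b : V -> W -> U) :
    (forall w, linear (b^~ w)) -> (forall v, linear (b v)) ->
  forall v w, tlift b (ptens v w) = b v w.
Proof.
move=> bl br v w.
pose fl w := GRing.isLinear.Build k V U _ (b^~ w) (bl w).
pose fr v := GRing.isLinear.Build k W U _ (b v) (br v).
pose gl w : {linear V -> U} := HB.pack (b^~ w) (fl w).
pose gr v : {linear W -> U} := HB.pack (b v) (fr v).
have -> : b v w = gl w v by [].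
rewrite [in RHS](coord_vbasis (memvf v)) linear_sum.
apply: eq_bigr => i _; rewrite linearZ /=.
have -> : b (vbasis {: V})`_i w = gr (vbasis {: V})`_i w by [].
rewrite [in RHS](coord_vbasis (memvf w)) linear_sum scaler_sumr.
by apply: eq_bigr => j _; rewrite mxE linearZ /= scalerA.
Qed.

End Tensor.

Section Hopf.
Variable k : fieldType.

(* comulM and comul1 say that comul is an algebra morphism into H (x) H, where
   (a (x) b) * (c (x) d) = (a * c) (x) (b * d). *)
Record hopf_structure (H : falgType k) := HopfStructure {
  comul : 'Hom(H, tens H H);
  counit : 'Hom(H, k^o);
  antipode : 'End(H);
  comulM : forall g h, comul (g * h) =
    tlift (fun g1 g2 => tlift (fun h1 h2 => ptens (g1 * h1) (g2 * h2))
                              (comul h)) (comul g);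
  comul1 : comul 1 = ptens 1 1;
  counitM : forall g h, counit (g * h) = counit g * counit h;
  counit1 : counit 1 = 1;
  comulA : forall h,
    tlift (fun h1 h2 => tlift (fun h11 h12 => ptens h11 (ptens h12 h2))
                              (comul h1)) (comul h) =
    tlift (fun h1 h2 => ptens h1 (comul h2)) (comul h);
  counitl : forall h, tlift (fun h1 h2 => counit h1 *: h2) (comul h) = h;
  counitr : forall h, tlift (fun h1 h2 => counit h2 *: h1) (comul h) = h;
  antipodel : forall h,
    tlift (fun h1 h2 => antipode h1 * h2) (comul h) = (counit h)%:A;
  antipoder : forall h,
    tlift (fun h1 h2 => h1 * antipode h2) (comul h) = (counit h)%:A
}.

Definition cocommutative (H : falgType k) (hH : hopf_structure H) :=
  forall h, tlift (fun h1 h2 => ptens h2 h1) (comul hH h) = comul hH h.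

Record module_algebra (H : falgType k) (hH : hopf_structure H)
    (L : falgType k) (act : 'Hom(H, 'End(L))) : Prop := ModuleAlgebra {
  act1 : forall s, act 1 s = s;
  actM : forall g h s, act (g * h) s = act g (act h s);
  act_unit : forall h, act h 1 = (counit hH h)%:A;
  act_mul : forall h s t,
    act h (s * t) = tlift (fun h1 h2 => act h1 s * act h2 t) (comul hH h)
}.

(* j (s (x) h) is the map t |-> s * (h t). *)
Definition hopf_galois_map (H L : falgType k) (act : 'Hom(H, 'End(L))) :
    tens L H -> 'End(L) :=
  tlift (fun s h => (amull s \o act h)%VF).

Definition hopf_galois (L : fieldExtType k) : Prop :=
  exists (H : falgType k) (hH : hopf_structure H) (act : 'Hom(H, 'End(L))),
    [/\ cocommutative hH, module_algebra hH act
      & bijective (hopf_galois_map act)].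

End Hopf.

Section GaloisClosure.
Variables (k : fieldType) (M : splittingFieldType k).
Implicit Types K F E : {subfield M}.

(* E is the Galois closure of K over k, inside the normal extension M. *)
Definition galois_closure K E : Prop :=
  [/\ (K <= E)%VS, galois 1%AS E
    & forall E', (K <= E')%VS -> galois 1%AS E' -> (E <= E')%VS].

(* In the library, the product x * y in 'Gal(E / 1) is "x, then y". Hence the
   left cosets of Gal(E / F) in Gal(E / k) for the composition of maps are the
   library's right cosets, and left translation acts on them through 'Rs. *)
Definition gal_cosets F E : {set {set gal_of E}} :=
  rcosets 'Gal(E / F) 'Gal(E / 1).

(* Permutations of the cosets are represented by the permutations of
   {set gal_of E} that fix everything else. *)
Definition gal_lambda F E (g : gal_of E) : {perm {set gal_of E}} :=
  restr_perm (gal_cosets F E) (actperm 'Rs g).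
Arguments gal_lambda F {E} g.

Lemma gal_lambdaE F E (g : gal_of E) x :
    g \in ('Gal(E / 1))%g -> x \in gal_cosets F E ->
  gal_lambda F g x = (x :* g)%g.
Proof.
move=> Gg Sx; have S y : y \in gal_cosets F E -> (y :* g)%g \in gal_cosets F E.
  case/rcosetsP=> a Ga ->; rewrite -rcosetM.
  by apply/rcosetsP; exists (a * g)%g; rewrite ?groupM.
rewrite /gal_lambda restr_permE ?actpermE //= ?rcosetE //.
rewrite !inE; apply/subsetP=> y Sy.
by rewrite inE /= apermE actpermE /= rcosetE; apply: S.
Qed.

Definition almost_classically_galois F : Prop :=
  exists2 E, galois_closure F E &
  exists N : {group {perm {set gal_of E}}},
    [/\ {in N, forall n, perm_on (gal_cosets F E) n},
        {in gal_cosets F E &, forall x y, exists! n, n \in N /\ n x = y},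
        gal_lambda F @: 'Gal(E / 1) \subset 'N(N)
      & N \subset gal_lambda F @: 'Gal(E / 1)]%g.

End GaloisClosure.

Arguments gal_lambda {k M} F {E} g.

(* A, acting on S, is the permutation group B of degree n, for some numbering
   of S. *)
Definition perm_similar (T : finType) (S : {set T}) (A : {set {perm T}})
    n (B : {set 'S_n}) : Prop :=
  exists f : 'I_n -> T,
    [/\ injective f, f @: setT = S &
        forall s : 'S_n,
          s \in B <-> exists2 a, a \in A & forall i, a (f i) = f (s i)].

Definition swap6 (i j : nat) : 'S_6 := tperm (inord i) (inord j).

(* 6T13 is generated by (2 4 6), (2 4) and (1 4)(2 5)(3 6) as a permutation
   group of {1, ..., 6}, renumbered here as {0, ..., 5}. *)
Definition F36_2 : {set 'S_6} :=
  <<[set swap6 1 3 * swap6 1 5; swap6 1 3;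
         swap6 0 3 * swap6 1 4 * swap6 2 5]>>%g.

(* Main.v *)
(* Let G be the Galois group, H the subgroup of G fixing F, and X the set of
   cosets of H, that is, the set of k-embeddings of F. If a Hopf algebra acts
   on F with j bijective, then for all embeddings x and y there is a unique
   element of E (x) Hopf algebra carrying x to y; uniqueness makes it grouplike,
   so these elements permute X regularly, and G normalizes them. Conversely a
   regular N normalized by G yields a Hopf-Galois structure on F by descending
   the group algebra E[N] along G.

   F36_2 has a normal subgroup V = A x B of order 9, where A and B act on the
   two blocks of three points. If 3 divides the order of H, every point of X is
   fixed by exactly one of A and B. If N is regular and normalized by G, then A
   and B centralize the same subgroup of index 2 in N, and the group of
   automorphisms of N centralizing it embeds into N. As 9 does not divide the
   order of N, V does not act faithfully on N; the involution that inverts A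
   and centralizes B then forces A to act trivially, which is absurd. If H has
   order 4, left translations by V and right translations by a Sylow 2-subgroup
   containing H generate a regular subgroup, but a normal complement of H would
   contain the commutators of F36_2, among them a conjugate of an element of H.
   If H is generated by a transposition, the even permutations complement H. *)

From HB Require Import structures.
Require Import Defs.
From mathcomp Require Import all_boot all_order all_algebra all_fingroup.
From mathcomp Require Import all_solvable all_field.

Set Implicit Arguments.
Unset Strict Implicit.
Unset Printing Implicit Defensive.

(** * Regular subgroups normalized by F36_2 *)

Section NoRegularSubgroup.
Local Open Scope group_scope.
Variables (T : finType) (N : {group {perm T}}).
Hypothesis N_trans : forall t u, exists2 p, p \in N & p t = u.
Hypothesis N_free : forall p t, p \in N -> p t = t -> p = 1.

Lemma semiregular_inj p q t : p \in N -> q \in N -> p t = q t -> p = q.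
Proof.
move=> Np Nq eqt; apply/eqP; rewrite eq_mulgV1; apply/eqP.
apply: (@N_free _ t); rewrite ?groupM ?groupV // permM.
by rewrite eqt permK.
Qed.

(** Since [a] fixes [t], evaluation at [t] turns conjugation by [a] on [N] into the action of [a] on
    [T], and freeness makes this evaluation injective. *)
Lemma fix_centraliser a n t :
  a \in 'N(N) -> n \in N -> a t = t -> (a (n t) == n t) = (n ^ a == n).
Proof.
move=> nNa Nn at_.
have aVt : a^-1 t = t by rewrite -{1}at_ permK.
have nat : (n ^ a) t = a (n t) by rewrite conjgE !permM aVt.
apply/eqP/eqP=> [eqn | eqn]; last by rewrite -nat eqn.
by apply: (@semiregular_inj _ _ t); rewrite ?memJ_norm ?nat.
Qed.

(** If [b] did not centralise [n], it would move [n t], so [a] would fix [n t]. As [n] commutes with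
    [a], then [a] would fix [t], which [b] fixes already. *)
Lemma fix_dichotomy a b n t :
    a \in 'N(N) -> b \in 'N(N) -> n \in N -> n ^ a = n ->
    (forall t, (a t == t) = (b t != t)) -> b t = t ->
  n ^ b = n.
Proof.
move=> nNa nNb Nn na ab bt; apply/eqP; rewrite -(fix_centraliser nNb Nn bt).
apply: contraT; rewrite -ab => /eqP fix_nt.
have nat : n (a t) = a (n t) by rewrite -{1}na conjgE !permM permK.
have : a t == t by rewrite -(inj_eq (@perm_inj _ n)) nat fix_nt.
by rewrite ab bt eqxx.
Qed.

(** The elements [a] and [b] centralise the same elements of [N], and they multiply an element [t]
    outside this centraliser by [ca] and [cb]. These two commute and have order 3. They generate a
    group of order 9 unless [b] acts on [N] as a power of [a], which conjugation by [c] excludes. *)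
Lemma no_regular_subgroup a b c t1 t2 :
    a \in 'N(N) -> b \in 'N(N) -> c \in 'N(N) ->
    a ^+ 3 = 1 -> b ^+ 3 = 1 -> commute a b -> a ^ c = a^-1 -> b ^ c = b ->
    (forall t, (a t == t) = (b t != t)) -> a t1 = t1 -> b t2 = t2 ->
  9 %| #|N|.
Proof.
move=> nNa nNb nNc a3 b3 cab ac bc ab at1 bt2.
have ba t : (b t == t) = (a t != t) by rewrite ab negbK.
have Cab n : n \in N -> (n ^ a == n) = (n ^ b == n).
  move=> Nn; apply/eqP/eqP => nE.
    exact: (fix_dichotomy nNa nNb Nn nE ab bt2).
  exact: (fix_dichotomy nNb nNa Nn nE ba at1).
(* Carrying a fixed point of [a] to a fixed point of [b], which [a] moves, forces [t] out of the
   centraliser of [a]. *)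
have [t Nt tt1] := N_trans t1 t2.
have Ct : t ^ a != t by rewrite -(fix_centraliser nNa Nt at1) tt1 ab bt2 eqxx.
(* The elements outside the centraliser form a single coset of it. Indeed [p^-1] takes [t2] to a
   point moved by [b], hence fixed by [a]; then [q] takes that point to one moved by [a], hence
   fixed by [b]. *)
have swap p q : p \in N -> q \in N -> p ^ a != p -> q ^ a != q ->
    (p^-1 * q) ^ a == p^-1 * q.
  move=> Np Nq Cp Cq; rewrite Cab ?groupM ?groupV //.
  rewrite -(fix_centraliser nNb _ bt2) ?groupM ?groupV //.
  have : a (p^-1 t2) == p^-1 t2.
    rewrite ab (fix_centraliser nNb) ?groupV // conjVg (inj_eq invg_inj).
    by rewrite -Cab.
  move/eqP=> ap; rewrite permM ba (fix_centraliser nNa) //.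
have Ca d : d \in [set a; b] -> (t ^ d) ^ a != t ^ d.
  move=> abd; rewrite -conjgM; have -> : d * a = a * d.
    by case/set2P: abd => ->.
  by rewrite conjgM (inj_eq (conjg_inj d)).
pose ca := t^-1 * t ^ a; pose cb := t^-1 * t ^ b.
have Nca : ca \in N by rewrite groupM ?groupV ?memJ_norm.
have Ncb : cb \in N by rewrite groupM ?groupV ?memJ_norm.
have ta : t ^ a = t * ca by rewrite mulKVg.
have tb : t ^ b = t * cb by rewrite mulKVg.
have ca_a : ca ^ a = ca by apply/eqP/swap; rewrite ?memJ_norm ?Ca ?set21.
have cb_a : cb ^ a = cb by apply/eqP/swap; rewrite ?memJ_norm ?Ca ?set22.
have ca_b : ca ^ b = ca by apply/eqP; rewrite -Cab // ca_a.
have cb_b : cb ^ b = cb by apply/eqP; rewrite -Cab // cb_a.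
clearbody ca cb.
have tX i : t ^ (a ^+ i) = t * ca ^+ i.
  elim: i => [|i IHi]; first by rewrite conjg1 mulg1.
  by rewrite expgSr conjgM IHi conjMg conjXg ca_a ta -mulgA -expgS.
have tXb i : t ^ (b ^+ i) = t * cb ^+ i.
  elim: i => [|i IHi]; first by rewrite conjg1 mulg1.
  by rewrite expgSr conjgM IHi conjMg conjXg cb_b tb -mulgA -expgS.
have ca3 : ca ^+ 3 = 1.
  by apply: (mulgI t); rewrite -tX a3 conjg1 mulg1.
have cb3 : cb ^+ 3 = 1.
  by apply: (mulgI t); rewrite -tXb b3 conjg1 mulg1.
have cc : commute ca cb.
  have tba : (t ^ b) ^ a = t * (ca * cb) by rewrite tb conjMg cb_a ta mulgA.
  have tab : (t ^ a) ^ b = t * (cb * ca) by rewrite ta conjMg ca_b tb mulgA.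
  by apply: (mulgI t); rewrite -tba -tab -!conjgM cab.
have ca1 : ca != 1.
  by apply: contra Ct => /eqP ca1; rewrite ta ca1 mulg1.
have cb1 : cb != 1.
  by rewrite -(inj_eq (mulgI t)) -tb mulg1 -Cab.
have oa : #[ca] = 3 by apply: nt_prime_order.
have ob : #[cb] = 3 by apply: nt_prime_order.
have [cb_ca | ] := boolP (<[cb]> \subset <[ca]>).
  have /cycleP[i cbE] : cb \in <[ca]> by rewrite -cycle_subG.
  pose d := a ^+ i.
  (* It is enough to compare [b] and [d] on [t] and on the centraliser: every other element of [N]
     is [t] times a centralised one. *)
  have bd n : n \in N -> n ^ b = n ^ d.
    have Cbd m : m \in N -> m ^ a = m -> m ^ b = m ^ d.
      move=> Nm ma; have /eqP -> : m ^ b == m by rewrite -Cab // ma.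
      by rewrite /d; elim: (i) => [|j IHj];
        rewrite ?conjg1 // expgSr conjgM -IHj.
    move=> Nn; have [/Cbd->// | Cn] := eqVneq (n ^ a) n.
    have tnE : n = t * (t^-1 * n) by rewrite mulKVg.
    rewrite {1}tnE [in RHS]tnE [LHS]conjMg [RHS]conjMg (Cbd (t^-1 * n));
      first last.
    - by apply/eqP; apply: swap.
    - by rewrite groupM ?groupV.
    by rewrite /d tX tb cbE.
  (* Conjugation by [c] preserves [b] and inverts [d]. *)
  have dV n : n \in N -> n ^ b = n ^ d^-1.
    move=> Nn; have [m Nm ->] : exists2 m, m \in N & n = m ^ c.
      by exists (n ^ c^-1); rewrite ?memJ_norm ?groupV // conjgKV.
    rewrite -{1}bc -conjJg bd // conjJg; congr (_ ^ _).
    by rewrite /d conjXg ac expgVn.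
  have /eqP : t ^ (d ^+ 2) = t.
    have Ntd : t ^ d \in N by rewrite memJ_norm // groupX.
    by rewrite expgS expg1 conjgM -bd // dV // conjgK.
  (* As [d] has exponent 3, it is the square of [d ^+ 2]; once [d ^+ 2] centralises [t], so does
     [d], and hence [b]. *)
  have d4 : d ^+ 2 * d ^+ 2 = d.
    by rewrite -expgD (expgD d 3 1) /d -expgM mulnC expgM a3 expg1n mul1g.
  move=> /eqP td2; have : t ^ d = t by rewrite -d4 conjgM !td2.
  by rewrite -bd // => /eqP; rewrite -Cab // (negPf Ct).
move=> nsub; have tiab := prime_TIg _ nsub.
have <- : #|<[cb]> * <[ca]>| = 9.
  by rewrite TI_cardMg ?tiab -?orderE ?oa ?ob.
rewrite -cent_joinEr; first by rewrite cardSg ?join_subG ?cycle_subG ?Nca ?Ncb.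
by rewrite cycle_subG /= cent_cycle; apply/cent1P.
Qed.
End NoRegularSubgroup.

(** * The permutation group F36_2 *)

Section F36_2_facts.
Local Open Scope group_scope.

(** Transpositions on plain natural numbers: after rewriting with [swap6E], products of
    transpositions evaluate by computation. *)
Let sw (i j n : nat) := if n == i then j else if n == j then i else n.

Let swap6E i j (z : 'I_6) :
  i < 6 -> j < 6 -> swap6 i j z = sw i j z :> nat.
Proof.
move=> li lj; rewrite permE /= -!val_eqE /= !inordK // /sw.
by rewrite !(fun_if (@nat_of_ord 6)) !inordK.
Qed.

(** The blocks are the odd and the even points. Here [o] is a 3-cycle and [t] a transposition of odd
    points; [s] exchanges the blocks, so [e] and [u] are the copies of [o] and [t] on the even
    points. *)
Let o : 'S_6 := swap6 1 3 * swap6 1 5.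
Let t : 'S_6 := swap6 1 3.
Let s : 'S_6 := swap6 0 3 * swap6 1 4 * swap6 2 5.
Let e : 'S_6 := o ^ s.
Let u : 'S_6 := t ^ s.

Let eq_perm6 (g h : 'S_6) : (forall x : 'I_6, g x = h x :> nat) -> g = h.
Proof. by move=> eq_gh; apply/permP=> x; apply/ord_inj. Qed.

Ltac perm6 := apply: eq_perm6; case=> -[|[|[|[|[|[|//]]]]]] ?;
  by rewrite ?/u ?/e ?/o ?/t ?/s ?permM ?perm1 !swap6E.

Let ss : s * s = 1. Proof. perm6. Qed.
Let sV : s^-1 = s. Proof. by apply/eqP; rewrite eq_invg_mul ss. Qed.
Let tV : t^-1 = t. Proof. by apply/eqP; rewrite eq_invg_mul; apply/eqP;
  perm6. Qed.
Let uV : u^-1 = u. Proof. by rewrite -conjVg tV. Qed.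
Let o3 : o ^+ 3 = 1. Proof. by rewrite !expgS expg0; perm6. Qed.
Let e3 : e ^+ 3 = 1. Proof. by rewrite -conjXg o3 conj1g. Qed.
Let ot : o ^ t = o^-1.
Proof.
apply: (mulgI o); rewrite mulgV conjgE tV !mulgA; perm6.
Qed.
Let oe : commute o e.
Proof. by rewrite /commute /e conjgE sV; perm6. Qed.
Let et : e ^ t = e.
Proof.
apply: (mulgI t); rewrite -conjgC /e conjgE sV; perm6.
Qed.
Let tu : commute t u.
Proof. by rewrite /commute /u conjgE sV; perm6. Qed.
Let es : e ^ s = o. Proof. by rewrite -conjgM ss conjg1. Qed.
Let ou : o ^ u = o. Proof. by rewrite /u -{1}es -conjJg et es. Qed.

Let fix_oe i : (o i == i) = (e i != i).
Proof.
rewrite -!val_eqE /= /e conjgE sV; case: i => -[|[|[|[|[|[|//]]]]]] ? /=;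
  by rewrite ?permM !swap6E.
Qed.

Let u_fix i : u i = sw 0 4 i :> nat.
Proof.
by rewrite /u conjgE sV; case: i => -[|[|[|[|[|[|//]]]]]] ? /=;
  rewrite ?permM !swap6E.
Qed.

Let So : o \in F36_2. Proof. by rewrite mem_gen // !inE eqxx. Qed.
Let St : t \in F36_2. Proof. by rewrite mem_gen // !inE eqxx orbT. Qed.
Let Ss : s \in F36_2. Proof. by rewrite mem_gen // !inE eqxx !orbT. Qed.
Let Se : e \in F36_2. Proof. by rewrite groupJ. Qed.
Let Su : u \in F36_2. Proof. by rewrite groupJ. Qed.

Let ord_o : #[o] = 3.
Proof.
apply: nt_prime_order => //; apply/eqP=> o1.
by have := fix_oe ord0; rewrite /e o1 conj1g perm1 eqxx.
Qed.
Let ord_e : #[e] = 3. Proof. by rewrite orderJ. Qed.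

Let fix_cycle (g h : 'S_6) i : h \in <[g]> -> g i = i -> h i = i.
Proof.
move=> gh gi; have sgC: <[g]> \subset 'C[i | 'P].
  by rewrite cycle_subG; apply/astab1P; rewrite /= apermE.
by have /astab1P := subsetP sgC h gh.
Qed.

Let cycle3 (a x : 'S_6) : #[a] = 3 -> x \in <[a]> -> x != 1 -> <[x]> = <[a]>.
Proof.
move=> oa ax x1; apply/esym/(nt_gen_prime (G := <[a]>%G)).
  by rewrite /= -orderE oa.
by rewrite !inE x1.
Qed.

(** Write [g] as [x * y]. Since [x] fixes [i], so does [y]; but a nontrivial power of [b] generates
    [<[b]>] and so moves [i]. Hence [y] is trivial. *)
Let cycle3_fix (g a b : 'S_6) i :
    #[a] = 3 -> #[b] = 3 -> b i != i -> a i = i ->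
  g \in <[a]> * <[b]> -> g != 1 -> g i = i -> <[g]> = <[a]>.
Proof.
move=> oa ob bi ai /mulsgP[x y ax bx ->] xy1.
rewrite permM (fix_cycle ax ai) => yi; have y1 : y = 1.
  apply: contraNeq bi => y1; apply/eqP/(fix_cycle _ yi).
  by rewrite (cycle3 ob bx y1) cycle_id.
by rewrite y1 mulg1 in xy1 *; apply: cycle3.
Qed.

Let coe : <[e]> \subset 'C(<[o]>).
Proof. by rewrite cycle_subG /= cent_cycle; apply/cent1P. Qed.

Let V := (<[o]> * <[e]>)%G.
Let defV : V = <[o]> * <[e]> :> {set 'S_6}.
Proof. exact: (cent_joinEr coe). Qed.

Let tiOE : <[o]> :&: <[e]> = 1.
Proof.
apply: prime_TIg; rewrite -?orderE ?ord_o //.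
apply/negP => sOE.
have oE : o \in <[e]> by rewrite -cycle_subG.
have eO : e \in <[o]>.
  rewrite (cycle3 ord_e oE) ?cycle_id //.
  by apply: contraTneq isT => o1; have := ord_o; rewrite o1 order1.
have := fix_oe ord0; case: eqP => [/(fix_cycle eO)-> | no0];
  first by rewrite eqxx.
by move/esym/negbFE/eqP/(fix_cycle oE).
Qed.

Let cardV : #|V| = 9.
Proof. by rewrite defV TI_cardMg // -!orderE ord_o ord_e. Qed.

(** Each of the three generators permutes the pair of subgroups [<[o]>] and [<[e]>], so all of
    [F36_2] does. *)
Let conj_oe g : g \in F36_2 ->
  <[o ^ g]> = <[o]> /\ <[e ^ g]> = <[e]> \/
  <[o ^ g]> = <[e]> /\ <[e ^ g]> = <[o]>.
Proof.
pose A : {set {set 'S_6}} := [set <[o]>; <[e]>].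
have nA : F36_2 \subset 'N(A | 'Js).
  rewrite gen_subG; apply/subsetP=> x Ax.
  have Js1 (y : 'S_6) : <[o]> :^ y \in A -> <[e]> :^ y \in A -> y \in 'N(A |
    'Js).
    move=> Ao Ae; rewrite !inE; apply/subsetP=> B.
    by rewrite !inE => /orP[] /eqP-> /=; rewrite -?in_set2.
  have eo : e ^ o = e by rewrite conjgE -oe mulKg.
  have oo : o ^ o = o by rewrite conjgE mulKg.
  case/setUP: Ax => [/set2P[]|/set1P] ->; rewrite -?/o -?/t -?/s;
    apply: Js1; rewrite -!cycleJ.
  - by rewrite oo set21.
  - by rewrite eo set22.
  - by rewrite ot cycleV set21.
  - by rewrite et set22.
  - by rewrite -/e set22.
  - by rewrite es set21.
move=> Sg; have nAg := subsetP nA g Sg.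
have Ae : <[e]> \in A by rewrite !inE eqxx orbT.
have Ao : <[o]> \in A by rewrite !inE eqxx.
have := astabs_act <[o]> nAg; have := astabs_act <[e]> nAg.
rewrite Ae Ao /= -!cycleJ !inE.
have neq : <[o]> != <[e]>.
  apply/eqP=> eqoe; have := tiOE; rewrite -eqoe setIid => /eqP.
  by rewrite trivg_card1 -orderE ord_o.
have neqg : <[o ^ g]> != <[e ^ g]>.
  rewrite !(cycleJ _ g); apply: contra neq => /eqP eqg; apply/eqP.
  by rewrite -(conjsgK g <[o]>) eqg conjsgK.
move=> /orP[] /eqP Eg /orP[] /eqP Og; rewrite Eg Og ?eqxx // in neqg *.
  by right.
by left.
Qed.

Let nVS : V <| F36_2.
Proof.
rewrite /normal join_subG !cycle_subG So Se /=; apply/subsetP=> g Sg.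
rewrite inE defV conjsMg -!cycleJ.
by have [[-> ->] | [-> ->]] := conj_oe Sg; rewrite // centC.
Qed.

(** The 3-part of 6! is 9, so [V] is already a Sylow subgroup of the full symmetric group. *)
Let sylV : 3.-Sylow(F36_2) V.
Proof.
rewrite pHallE normal_sub ?nVS //= cardV eqn_dvd.
apply/andP; split.
  have p9 : 3.-nat 9 by [].
  by rewrite -(part_pnat_id p9) -cardV partn_dvd ?cardG_gt0 ?cardSg ?normal_sub
    ?nVS.
rewrite (dvdn_trans (partn_dvd _ _ (cardSg (subsetT _)))) ?cardG_gt0 //.
by rewrite cardsT card_Sn p_part.
Qed.

Let in_V g i : g \in V -> g != 1 -> g i = i ->
  if o i == i then <[g]> = <[o]> else <[g]> = <[e]>.
Proof.
rewrite -[g \in V]/(g \in (V : {set _})) defV => OEg g1 gi.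
have := fix_oe i; case: eqP => [oi /esym ei | /eqP oi /esym/negbFE/eqP ei].
  exact: (cycle3_fix _ _ ei oi).
by apply: (cycle3_fix _ _ oi ei) => //; rewrite (centC coe).
Qed.

(** An element of order 3 in [H] lies in the normal Sylow subgroup [V], and fixing [i] it generates
    [<[o]>] or [<[e]>]. Only one of the two can be in [H], since no point is fixed by both, and
    conjugation permutes them. *)
Lemma F36_2_order3 (H : {group 'S_6}) i :
    H \subset F36_2 -> (forall h, h \in H -> h i = i) -> 3 %| #|H| ->
  exists a b c : 'S_6,
    [/\ [/\ a \in F36_2, b \in F36_2 & c \in F36_2],
        [/\ a ^+ 3 = 1, b ^+ 3 = 1, commute a b, a ^ c = a^-1 & b ^ c = b],
        forall g, g \in F36_2 -> (a ^ g \in H) = (b ^ g \notin H),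
        exists2 g, g \in F36_2 & a ^ g \in H
      & exists2 g, g \in F36_2 & b ^ g \in H].
Proof.
move=> sHS Hi /Cauchy[// |g Hg og].
have Vg : g \in V.
  by rewrite (mem_normal_Hall sylV) ?nVS ?(subsetP sHS) // /p_elt og pnat_id.
have g1 : g != 1 by rewrite -order_eq1 og.
have HOE : (<[o]> \subset H) = ~~ (<[e]> \subset H).
  have := in_V Vg g1 (Hi g Hg).
  have := fix_oe i; case: eqP => [oi | /eqP oi] ei <-;
    rewrite [in LHS]cycle_subG.
    rewrite Hg cycle_subG; apply/esym/negP => /Hi/eqP.
    by rewrite (negPf (esym ei)).
  rewrite cycle_subG Hg; apply/negP => /Hi/eqP.
  by rewrite (negPf oi).
exists o, e, t; split=> //.
- move=> x Sx; rewrite -!cycle_subG.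
  by have [[-> ->] | [-> ->]] := conj_oe Sx; rewrite HOE ?negbK.
- have [sOH | nOH] := boolP (<[o]> \subset H).
    by exists 1 => //; rewrite conjg1 -cycle_subG.
  by exists s => //; rewrite -/e -cycle_subG; rewrite HOE negbK in nOH.
have [sOH | nOH] := boolP (<[o]> \subset H).
  by exists s => //; rewrite es -cycle_subG.
by exists 1 => //; rewrite conjg1 -cycle_subG; rewrite HOE negbK in nOH.
Qed.

Lemma F36_2_trans i j : exists2 g, g \in F36_2 & g i = j.
Proof.
(* From the even point 2, [s] crosses to the odd block, powers of [o] run through that block, and a
   second [s] comes back. *)
suff go k : exists2 g, g \in F36_2 & g (inord 2) = k.
  have [g Sg gi] := go i; have [h Sh <-] := go j.
  by exists (g^-1 * h); rewrite ?groupM ?groupV // permM -gi permK.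
have val2 : (inord 2 : 'I_6) = 2 :> nat by rewrite inordK.
have Sso := groupM Ss So; have Ssoo := groupM Sso So.
case: k => -[|[|[|[|[|[|//]]]]]] lt_k.
- exists (s * o * o * s); first exact: groupM.
  by apply/ord_inj; rewrite ?permM !swap6E // val2.
- exists (s * o); first by [].
  by apply/ord_inj; rewrite ?permM !swap6E // val2.
- by exists 1; rewrite ?group1 // perm1; apply/ord_inj.
- exists (s * o * o); first by [].
  by apply/ord_inj; rewrite ?permM !swap6E // val2.
- exists (s * o * s); first exact: groupM.
  by apply/ord_inj; rewrite ?permM !swap6E // val2.
exists s; first by [].
by apply/ord_inj; rewrite ?permM !swap6E // val2.
Qed.


(** The permutations that respect the two blocks are those that preserve equality of parity. On
    lists of values they can be counted by evaluation. *)
Let parity_list (l : seq nat) :=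
  all (fun i => all (fun j =>
    (odd (nth 0 l i) == odd (nth 0 l j)) == (odd i == odd j)) (iota 0 6))
    (iota 0 6).

Let parity (g : 'S_6) :=
  [forall i, forall j, (odd (g i) == odd (g j)) == (odd i == odd j)].

Let F36_2_parity g : g \in F36_2 -> parity g.
Proof.
have gP : group_set [set g | parity g].
  apply/group_setP; split=> [|x y]; rewrite !inE.
    by apply/'forall_forallP => i j; rewrite !perm1.
  move=> /'forall_forallP xP /'forall_forallP yP.
  by apply/'forall_forallP=> i j; rewrite !permM (eqP (yP _ _)).
suff sP : F36_2 \subset Group gP by move/(subsetP sP); rewrite inE.
rewrite gen_subG; apply/subsetP=> x /setUP[/set2P[]|/set1P] ->;
  rewrite inE; apply/'forall_forallP; case=> -[|[|[|[|[|[|//]]]]]] ?;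
  by case=> -[|[|[|[|[|[|//]]]]]] ?; rewrite ?permM !swap6E.
Qed.

(** Of the 720 permutations of six points, exactly 72 respect the two blocks. *)
Let card_le : #|F36_2| <= 72.
Proof.
pose f (g : 'S_6) := [seq (g i : nat) | i : 'I_6].
have f_inj : injective f.
  by move=> g h /eq_in_map eqf; apply/permP=> i; apply/ord_inj/eqf;
    rewrite mem_enum.
pose L := [seq l <- permutations (iota 0 6) | parity_list l].
have <- : size L = 72 by vm_compute.
rewrite cardE -(size_map f); apply: uniq_leq_size.
  by rewrite map_inj_uniq ?enum_uniq.
move=> _ /mapP[g + ->]; rewrite mem_enum => /F36_2_parity/'forall_forallP gP.
have nth_f (i : 'I_6) : nth 0 (f g) i = g i.
  by rewrite (nth_map i) ?size_enum_ord // nth_ord_enum.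
rewrite mem_filter; apply/andP; split.
  apply/allP=> i; rewrite mem_iota => /andP[_ lti].
  apply/allP=> j; rewrite mem_iota => /andP[_ ltj].
  by rewrite (nth_f (Ordinal lti)) (nth_f (Ordinal ltj)) gP.
have uf : uniq (f g).
  by rewrite (map_inj_uniq (inj_comp val_inj (@perm_inj _ g))) enum_uniq.
have sf : {subset f g <= iota 0 6}.
  by move=> _ /mapP[i _ ->]; rewrite mem_iota /=.
rewrite mem_permutations uniq_perm ?iota_uniq //.
by have [|_ eqf] := uniq_min_size uf sf;
  [rewrite size_map size_enum_ord | exact: eqf].
Qed.

(** For the lower bound, [<[o]>] has two conjugates, and its normaliser contains [V] of order 9 and
    the group of order 4 generated by [t] and [u]. So 36 divides the order of the normaliser. *)
Lemma card_F36_2 : #|F36_2| = 72.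
Proof.
apply/eqP; rewrite eqn_leq card_le dvdn_leq ?cardG_gt0 //=.
have orb : orbit 'Js F36_2 <[o]> = [set <[o]>; <[e]>].
  apply/setP=> B; rewrite !inE; apply/orbitP/orP=> [[g Sg /= <-] | ].
    by rewrite -(cycleJ _ g); have [[-> _]|[-> _]] := conj_oe Sg; [left|right].
  case=> /eqP ->; first by exists 1; rewrite ?group1 //= conjsg1.
  by exists s => //=; rewrite -(cycleJ _ s).
have := card_orbit 'Js [group of F36_2] <[o]>.
rewrite orb cards2 astab1Js => ind.
have -> : (72 = 36 * 2)%N by [].
rewrite -(Lagrange (subsetIl F36_2 'N(<[o]>))) -ind.
have -> : <[o]> != <[e]>.
  apply/eqP=> eqoe; have := tiOE; rewrite -eqoe setIid => /eqP.
  by rewrite trivg_card1 -orderE ord_o.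
rewrite dvdn_pmul2r // (@Gauss_dvd 4 9) //; apply/andP; split.
  have ot2 : #[t] = 2.
    apply: nt_prime_order => //; first by rewrite expgS expg1 -{1}tV mulVg.
    apply/eqP=> t1; have := congr1 (fun g : 'S_6 => g (inord 1) : nat) t1.
    by rewrite perm1 swap6E // inordK.
  have ou2 : #[u] = 2 by rewrite orderJ.
  have tiTU : <[t]> :&: <[u]> = 1.
    apply: prime_TIg; rewrite -?orderE ?ot2 // cycle_subG.
    apply/negP => /fix_cycle/(_ (_ : u (inord 1) = inord 1)) t1.
    have /t1/(congr1 (@nat_of_ord 6)) : u (inord 1) = inord 1.
      by apply/ord_inj; rewrite u_fix inordK.
    by rewrite swap6E // inordK.
  have cTU : <[u]> \subset 'C(<[t]>).
    by rewrite cycle_subG /= cent_cycle; apply/cent1P.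
  have cardTU : #|<[t]> <*> <[u]>| = 4.
    by rewrite (cent_joinEr cTU) TI_cardMg // -!orderE ot2 ou2.
  apply: (@dvdn_trans #|<[t]> <*> <[u]>|); first by rewrite cardTU.
  rewrite cardSg // subsetI !join_subG !cycle_subG St Su /=.
  by rewrite !inE -!(cycleJ _ _) ot ou cycleV !subxx.
apply: (@dvdn_trans #|V|); first by rewrite cardV.
rewrite cardSg // subsetI normal_sub ?nVS //=.
by rewrite defV mul_subG ?normG // cents_norm // coe.
Qed.


Lemma F36_2_normal9 : exists2 W : {group 'S_6}, W <| F36_2 & #|W| = 9.
Proof. by exists V; [apply: nVS | apply: cardV]. Qed.

(** A point moved by [t] is odd, hence fixed by [u]. *)
Lemma F36_2_transposition i :
  exists j k, [/\ tperm j k \in F36_2, j != k & tperm j k i = i].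
Proof.
have u_tperm : u = tperm (inord 4) (inord 0).
  apply/permP=> x; apply/ord_inj; rewrite u_fix -/(swap6 4 0) swap6E //.
  by rewrite /sw; case: eqP => [-> | _] //; case: eqP => // ->.
have [ti | ti] := eqVneq (t i) i.
  by exists (inord 1), (inord 3); split;
    rewrite -/(swap6 1 3) // -val_eqE /= !inordK.
exists (inord 4), (inord 0); rewrite -u_tperm; split=> //.
  by rewrite -val_eqE /= !inordK.
apply/ord_inj; rewrite u_fix; move: ti; rewrite -val_eqE /= swap6E //.
by case: (nat_of_ord i) => [|[|[|[|[|[|]]]]]].
Qed.

(** The quotient by [N] has order 4, so [N] contains the commutators. One of them is an involution
    with a fixed point. A conjugate of it lies in the stabiliser of [i], of order 12, and by Sylow a
    further conjugate lies in [H]; it is still in [N]. *)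
Lemma F36_2_no_complement (N H : {group 'S_6}) i :
    N <| F36_2 -> #|N| = 18 -> H \subset F36_2 ->
    (forall h, h \in H -> h i = i) -> #|H| = 4 -> H :&: N != 1.
Proof.
move=> nNS oN sHS Hi oH.
have nNF := normal_norm nNS.
have abN : abelian (F36_2 / N).
  have oq : #|F36_2 / N| = 4.
    by rewrite card_quotient // -divgS ?normal_sub // card_F36_2 oN.
  by apply: (@p2group_abelian _ 2); rewrite /pgroup oq.
(* This is the commutator of [t] and [s], because [u] is [t ^ s]. *)
pose z : 'S_6 := t * u.
have Nz : z \in N.
  apply: (subsetP (der1_min nNF abN)).
  by rewrite /z -tV; apply: mem_commg.
have z2 : z ^+ 2 = 1.
  have sq2 (x : 'S_6) : x^-1 = x -> x ^+ 2 = 1.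
    by move=> xV; rewrite expgS expg1 -{1}xV mulVg.
  by rewrite /z expgMn // !sq2 ?mulg1 ?tV ?uV.
(* The point 2 is fixed by [z], which exchanges 1 with 3 and 0 with 4. *)
have [g Sg gi] := F36_2_trans (inord 2) i.
have zgi : (z ^ g) i = i.
  rewrite -gi -permM -conjgC permM /z; congr (g _).
  by apply/ord_inj; rewrite permM u_fix swap6E // inordK.
pose Si := 'C_F36_2[i | 'P].
have oSi : #|Si| = 12.
  have := card_orbit_stab 'P [group of F36_2] i.
  have -> : orbit 'P F36_2 i = setT.
    apply/setP=> j; rewrite inE; apply/orbitP.
    by have [h Sh <-] := F36_2_trans i j; exists h.
  by rewrite cardsT card_ord card_F36_2 -[72]/(6 * 12)%N => /eqP;
    rewrite eqn_pmul2l // => /eqP.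
have sHSi : H \subset Si.
  rewrite subsetI sHS; apply/subsetP=> h Hh.
  by apply/astab1P; apply: Hi.
have sylH : 2.-Sylow(Si) H.
  by rewrite pHallE sHSi oSi oH p_part.
have szgS : <[z ^ g]> \subset Si.
  rewrite cycle_subG; apply/setIP; split; last exact/astab1P.
  exact: groupJ (subsetP (normal_sub nNS) z Nz) Sg.
have pz : 2.-group <[z ^ g]>.
  apply: (@pnat_dvd _ 2) => //; rewrite -orderE orderJ.
  by rewrite order_dvdn z2.
have [x Six] := Sylow_Jsub sylH szgS pz.
rewrite -cycleJ cycle_subG => Hzgx.
have Sx : x \in F36_2 by case/setIP: Six.
have Nzgx : (z ^ g) ^ x \in N by rewrite !memJ_norm ?(subsetP nNF).
apply/trivgPn; exists ((z ^ g) ^ x); first by rewrite inE Hzgx.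
rewrite !conjg_eq1; apply/eqP=> z1.
have := congr1 (fun h : 'S_6 => h (inord 1) : nat) z1.
by rewrite permM u_fix perm1 swap6E // inordK.
Qed.

End F36_2_facts.

Import GRing.Theory.
Local Open Scope ring_scope.

(** * From Hopf actions to regular subgroups *)

Section TensorLift.
Variables (k : fieldType) (V W : vectType k).

Lemma tlift_is_linear (U : lmodType k) (b : V -> W -> U) : linear (tlift b).
Proof.
move=> a s t; rewrite /tlift scaler_sumr -big_split /=; apply: eq_bigr => i _.
rewrite scaler_sumr -big_split /=; apply: eq_bigr => j _.
by rewrite !mxE scalerDl scalerA.
Qed.

HB.instance Definition _ (U : lmodType k) (b : V -> W -> U) :=
  GRing.isLinear.Build k (tens V W) U _ (tlift b) (tlift_is_linear b).

Lemma eq_tlift (U : lmodType k) (b c : V -> W -> U) t :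
  (forall v w, b v w = c v w) -> tlift b t = tlift c t.
Proof.
by move=> eqbc; apply: eq_bigr => i _; apply: eq_bigr => j _; rewrite eqbc.
Qed.

Lemma linear_tlift (U U' : lmodType k) (f : {linear U -> U'})
    (b : V -> W -> U) t :
  f (tlift b t) = tlift (fun v w => f (b v w)) t.
Proof.
rewrite linear_sum; apply: eq_bigr => i _; rewrite linear_sum.
by apply: eq_bigr => j _; rewrite linearZ.
Qed.

End TensorLift.

Lemma lfun_exists (k : fieldType) (V W : vectType k) (f : V -> W) :
  linear f -> exists h : 'Hom(V, W), h =1 f.
Proof.
move=> lf; pose F : {linear V -> W} := HB.pack f
  (GRing.isLinear.Build k V W _ f lf).
by exists (linfun F) => v; rewrite lfunE.
Qed.

Lemma linear_bij_dim (k : fieldType) (V W : vectType k) (f : V -> W) :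
  linear f -> bijective f -> \dim {: V} = \dim {: W}.
Proof.
case/lfun_exists=> F FE [g fK gK].
have kF: lker F == 0%VS.
  by apply/lker0P => u v; rewrite !FE; apply: (can_inj fK).
rewrite -(limg_dim_eq (f := F)); last by rewrite (eqP kF) capv0.
congr (\dim _); apply/eqP; rewrite eqEsubv subvf; apply/subvP=> w _.
by rewrite -[w]gK -FE memv_img ?memvf.
Qed.

Lemma ahom_exists (k : fieldType) (L E : falgType k) (f : L -> E) :
    linear f -> (forall s t, f (s * t) = f s * f t) -> f 1 = 1 ->
  exists h : 'AHom(L, E), h =1 f.
Proof.
case/lfun_exists=> F FE fM f1; have hF: ahom_in {: L} F.
  by apply/ahom_inP; split=> [s t _ _|]; rewrite !FE.
by exists (AHom hF).
Qed.

Section RegularSubgroup.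
Variables (k : fieldType) (L : falgType k) (E : fieldExtType k).
Variables (T : finType) (x : T -> 'AHom(L, E)).
Hypothesis x_inj : injective x.
Hypothesis x_surj : forall f : 'AHom(L, E), exists t, x t = f.

Section Action.
Variables (H : falgType k) (hH : hopf_structure H) (act : 'Hom(H, 'End(L))).
Hypothesis actH : module_algebra hH act.
Hypothesis act_bij : bijective (hopf_galois_map act).

Local Notation n := (\dim {: L}).
Local Notation m := (\dim {: H}).
Local Notation bL := (vbasis {: L}).
Local Notation bH := (vbasis {: H}).

Lemma hopf_galois_dim : m = n.
Proof.
have lj : linear (hopf_galois_map act) by exact: tlift_is_linear.
have := linear_bij_dim lj act_bij.
have -> : \dim {: tens L H} = (n * m)%N by transitivity (dim ('M[k]_(n, m)));
  [apply: dimvf | ].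
have -> : \dim {: 'End(L)} = (n * n)%N.
  by transitivity (dim L * dim L)%N; [apply: dimvf | rewrite dimvf].
by move/eqP; rewrite eqn_pmul2l ?adim_gt0 // => /eqP.
Qed.

Let R t : 'rV[E]_n := \row_i x t bL`_i.
Let P t : 'M[E]_(m, n) := \matrix_(j, i) x t (act bH`_j bL`_i).

Let R_inj t u : R t = R u -> t = u.
Proof.
move=> eqR; apply/x_inj/val_inj/lfunP => s /=.
rewrite (coord_vbasis (memvf s)) !linear_sum; apply: eq_bigr => i _.
by move/rowP/(_ i): eqR; rewrite !mxE => eqRi; rewrite !linearZ /= eqRi.
Qed.

(** Read [e] as an element of E (x) H. The matrix equation says that [e] carries the embedding [x t]
    to [x u]. *)
Let rowP_all t u e :
  R u = e *m P t <-> forall s, x u s = \sum_j e 0 j * x t (act bH`_j s).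
Proof.
split=> [eqR s | eqx]; last by apply/rowP=> i; rewrite !mxE eqx;
  apply: eq_bigr => j _; rewrite mxE.
have xE j : e 0 j * x t (act bH`_j s) =
    \sum_i coord bL i s *: (e 0 j * P t j i).
  rewrite [in LHS](coord_vbasis (memvf s)) !linear_sum mulr_sumr.
  by apply: eq_bigr => i _; rewrite mxE !linearZ /= scalerAr.
rewrite [in LHS](coord_vbasis (memvf s)) linear_sum (eq_bigr _ (fun j _ =>
  xE j)).
rewrite exchange_big /=; apply: eq_bigr => i _; move/rowP/(_ i): eqR.
by rewrite !mxE linearZ /= => ->; rewrite scaler_sumr.
Qed.

(** By surjectivity of j, each coordinate form of [L] (as an endomorphism with values in the
    scalars) is a sum of maps s * (h _). Applying [x t] to the factors s gives a left inverse of
    [P t], which is two-sided because [H] and [L] have equal dimension. *)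
Let Q_ex t : exists Q : 'M[E]_(n, m), Q *m P t = 1%:M /\ P t *m Q = 1%:M.
Proof.
have [g _ gK] := act_bij.
have /fin_all_exists[f fE]: forall i : 'I_n, exists f : 'End(L),
    forall s, f s = coord bL i s *: 1.
  by move=> i; apply: lfun_exists => a r s; rewrite linearP scalerDl scalerA.
pose Q : 'M[E]_(n, m) :=
  \matrix_(i, j) \sum_l (g (f i)) l j *: x t bL`_l.
have QP : Q *m P t = 1%:M.
  apply/matrixP=> i i'; rewrite !mxE.
  transitivity (x t (f i bL`_i')); last first.
    by rewrite fE coord_free ?(basis_free (vbasisP _)) //
      linearZ /= rmorph1 scaler_nat eq_sym.
  rewrite -[in RHS](gK (f i)) /hopf_galois_map /tlift sum_lfunE linear_sum.
  under eq_bigr => j _ do rewrite !mxE mulr_suml.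
  rewrite exchange_big /=; apply: eq_bigr => l _.
  rewrite sum_lfunE linear_sum; apply: eq_bigr => j _.
  by rewrite scale_lfunE comp_lfunE lfunE /= linearZ /= rmorphM /= scalerAl.
exists Q; split=> //.
have Pfree : row_free (P t).
  rewrite /row_free eqn_leq rank_leq_row /=.
  apply: (@leq_trans n); first by rewrite hopf_galois_dim.
  by rewrite -[X in (X <= _)%N](mxrank1 E) -QP mxrankM_maxr.
by apply: (row_free_inj Pfree); rewrite -mulmxA QP mulmx1 mul1mx.
Qed.

Let P_inj t (e f : 'rV_m) : e *m P t = f *m P t -> e = f.
Proof.
have [Q [_ PQ]] := Q_ex t => /(congr1 (mulmx^~ Q)).
by rewrite -!mulmxA PQ !mulmx1.
Qed.

(* The row e stands for the element \sum_j e_j (x) h_j of E (x) H. *)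
Let grouplike (e : 'rV[E]_m) :=
  \sum_j e 0 j * (counit hH bH`_j)%:A = 1 /\
  forall a b, \sum_j e 0 j * (comul hH bH`_j a b)%:A = e 0 a * e 0 b.

Let actM_E t (e : 'rV[E]_m) (s s' : L) :
  \sum_j e 0 j * x t (act bH`_j (s * s')) =
  \sum_a \sum_b (\sum_j e 0 j * (comul hH bH`_j a b)%:A) *
    (x t (act bH`_a s) * x t (act bH`_b s')).
Proof.
under eq_bigr => j _ do rewrite (act_mul actH) linear_tlift mulr_sumr.
rewrite exchange_big /=; apply: eq_bigr => a _.
under eq_bigr => j _ do rewrite mulr_sumr.
rewrite exchange_big /=; apply: eq_bigr => b _.
rewrite mulr_suml; apply: eq_bigr => j _.
by rewrite rmorphM -mulrA mulr_algl.
Qed.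

(** Evaluating the multiplicative map [x u] on products of basis vectors shows that the coproduct of
    [e] and e (x) e agree between [P t] and its transpose; both can be cancelled since [P t] is
    invertible. *)
Let grouplikeP t u e : R u = e *m P t -> grouplike e.
Proof.
move/rowP_all=> eqx; split.
  transitivity (x u 1); last by rewrite rmorph1.
  rewrite eqx; apply: eq_bigr => j _.
  by rewrite (act_unit actH) linearZ /= rmorph1.
have [Q [_ PQ]] := Q_ex t.
pose D : 'M[E]_m := \matrix_(a, b) (\sum_j e 0 j * (comul hH bH`_j a b)%:A).
suff eqD : D = e^T *m e.
  move=> a b; have := congr1 (fun M : 'M_m => M a b) eqD.
  by rewrite !mxE big_ord1 mxE.
suff eqPD : (P t)^T *m D *m P t = (P t)^T *m (e^T *m e) *m P t.
  have := congr1 (fun M => Q^T *m M *m Q) eqPD.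
  by rewrite -!mulmxA PQ !mulmx1 !mulmxA -!trmx_mul PQ trmx1 !mul1mx mulmx1.
apply/matrixP=> i i'.
transitivity (x u (bL`_i * bL`_i')).
  rewrite eqx actM_E !mxE exchange_big; apply: eq_bigr => b _.
  rewrite !mxE mulr_suml; apply: eq_bigr => a _.
  by rewrite !mxE mulrCA mulrA.
rewrite rmorphM /= !eqx -!mulmxA mulmxA -trmx_mul.
rewrite mxE big_ord1 !mxE.
by congr (_ * _); apply: eq_bigr => j _; rewrite mxE.
Qed.

(** A grouplike element turns the algebra morphism [x u] into another algebra morphism, and every
    such morphism is some [x w]. *)
Let grouplike_act e u : grouplike e -> exists w, R w = e *m P u.
Proof.
case=> e1 eM.
have [||//|f Df] := ahom_exists (f :=
  fun s => \sum_j e 0 j * x u (act bH`_j s)).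
- move=> a s s'; rewrite scaler_sumr -big_split /=; apply: eq_bigr => j _.
  by rewrite !linearP mulrDr -scalerAr.
- move=> s s' /=; rewrite actM_E mulr_suml; apply: eq_bigr => a _.
  rewrite mulr_sumr; apply: eq_bigr => b _.
  by rewrite eM mulrACA.
- rewrite -e1; apply: eq_bigr => j _.
  by rewrite (act_unit actH) linearZ /= rmorph1.
by have [w xw] := x_surj f; exists w; apply/rowP_all => s; rewrite xw Df.
Qed.

(** The row [f *m A e] represents the product of [e] and [f], in this order, in E (x) H. *)
Let A (e : 'rV[E]_m) : 'M[E]_m :=
  \matrix_(j, r) \sum_l e 0 l * (coord bH r (bH`_l * bH`_j))%:A.

Let P_act e u w : R w = e *m P u -> P w = A e *m P u.
Proof.
move/rowP_all=> eqx; apply/matrixP=> j i; rewrite !mxE eqx.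
under [RHS]eq_bigr => r _ do rewrite !mxE mulr_suml.
rewrite exchange_big /=; apply: eq_bigr => l _.
rewrite -(Defs.actM actH) [in LHS](coord_vbasis (memvf (bH`_l * bH`_j))).
rewrite linear_sum /= sum_lfunE linear_sum mulr_sumr; apply: eq_bigr => r _.
by rewrite linearZ scale_lfunE linearZ /= -mulrA mulr_algl.
Qed.

Let e1 : 'rV[E]_m := \row_j (coord bH j 1)%:A.

Let R_act1 u : R u = e1 *m P u.
Proof.
apply/rowP_all=> s; rewrite -[in LHS](Defs.act1 actH s).
rewrite [X in act X](coord_vbasis (memvf 1)) linear_sum sum_lfunE linear_sum.
by apply: eq_bigr => j _; rewrite mxE linearZ scale_lfunE linearZ mulr_algl.
Qed.


Let inN (p : {perm T}) := exists e, forall u, R (p u) = e *m P u.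

(** Decidable form of [inN]: because [P t] is injective on rows, [e] can be solved for from the
    image of any one point. *)
Let inNb (p : {perm T}) :=
  [forall t, forall u, (R (p t) <= P t)%MS &&
     (R (p u) == R (p t) *m pinvmx (P t) *m P u)].

Let inNP p : reflect (inN p) (inNb p).
Proof.
apply: (iffP 'forall_forallP) => [eqp | [e eqp] t u].
  (* When [T] is empty there is no point to solve at, and any row will do. *)
  have [t _ | T0] := pickP (mem T); last by exists 0 => u; have := T0 u.
  by exists (R (p t) *m pinvmx (P t)) => u; have /andP[_ /eqP] := eqp t u.
have Rp : (R (p t) <= P t)%MS by rewrite eqp submxMl.
rewrite Rp /= eqp; apply/eqP; congr (_ *m _); apply: (@P_inj t).
by rewrite mulmxKpV ?eqp ?submxMl.
Qed.

Let inN_mul p q : inN p -> inN q -> inN (p * q)%g.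
Proof.
move=> [e eqp] [f eqq]; exists (f *m A e) => u.
by rewrite permM eqq (P_act (eqp u)) mulmxA.
Qed.

Let inN_group : group_set [set p | inNb p].
Proof.
apply/group_setP; split=> [|p q]; rewrite !inE.
  by apply/inNP; exists e1 => u; rewrite perm1.
by move=> /inNP Np /inNP Nq; apply/inNP/inN_mul.
Qed.

(** The elements [e] from [t] to [w] and [f] from [w] to [t] are both grouplike, so each maps [T] to
    itself. Their product fixes [t] and so is the unit by uniqueness, which makes the map of [e]
    injective. *)
Let inN_trans t w : exists2 p, inN p & p t = w.
Proof.
have [[Qt [QPt _]] [Qw [QPw _]]] := (Q_ex t, Q_ex w).
pose e := R w *m Qt; pose f := R t *m Qw.
have Re : R w = e *m P t by rewrite -mulmxA QPt mulmx1.
have Rf : R t = f *m P w by rewrite -mulmxA QPw mulmx1.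
have /fin_all_exists[pe Dpe] : forall u, exists v, R v = e *m P u.
  by move=> u; apply/grouplike_act/(grouplikeP Re).
have /fin_all_exists[pf Dpf] : forall u, exists v, R v = f *m P u.
  by move=> u; apply/grouplike_act/(grouplikeP Rf).
have fe1 : f *m A e = e1.
  by apply: (@P_inj t); rewrite -mulmxA -(P_act Re) -Rf R_act1.
have peK : cancel pe pf.
  by move=> u; apply: R_inj; rewrite Dpf (P_act (Dpe u)) mulmxA fe1 -R_act1.
exists (perm (can_inj peK)); last by apply: R_inj; rewrite permE Dpe.
by exists e => u; rewrite permE Dpe.
Qed.

Let inN_free p t : inN p -> p t = t -> p = 1%g.
Proof.
move=> [e eqp] pt; apply/permP=> u; apply: R_inj; rewrite perm1 eqp.
suff -> : e = e1 by rewrite -R_act1.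
by apply: (@P_inj t); rewrite -eqp pt -R_act1.
Qed.

(** The automorphism [s] acts on E (x) H through the first factor; applying it to the entries of [e]
    conjugates the induced permutation by [p]. *)
Let inN_norm (s : 'AEnd(E)) (p q : {perm T}) :
  (forall t a, s (x t a) = x (p t) a) -> inN q -> inN (q ^ p)%g.
Proof.
move=> sx [e eqq]; exists (map_mx s e) => u.
have sR t : map_mx s (R t) = R (p t) by apply/rowP=> i; rewrite !mxE sx.
have sP t : map_mx s (P t) = P (p t).
  by apply/matrixP=> i j; rewrite !mxE sx.
by rewrite -{2}[u](permKV p) -sP -map_mxM -eqq sR !permM.
Qed.

Lemma regular_subgroup_of_action : exists N : {group {perm T}},
  [/\ forall t u, exists2 p, p \in N & p t = u,
      forall p t, p \in N -> p t = t -> p = 1%g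
    & forall (s : 'AEnd(E)) (p : {perm T}),
        (forall t a, s (x t a) = x (p t) a) -> p \in 'N(N)%g].
Proof.
exists (Group inN_group); split=> [t u | p t | s p sx].
- by have [p Np pt] := inN_trans t u; exists p => //; rewrite inE; apply/inNP.
- by rewrite inE => /inNP/inN_free; apply.
rewrite inE; apply/subsetP=> _ /imsetP[q + ->]; rewrite !inE.
by move=> /inNP Nq; apply/inNP/(inN_norm sx).
Qed.

End Action.
End RegularSubgroup.

(** * From regular subgroups to Hopf actions *)

Lemma tlift_sum (k : fieldType) (V W : vectType k) (U : lmodType k)
    (I : finType) (F : I -> V -> W -> U) t :
  tlift (fun v w => \sum_i F i v w) t = \sum_i tlift (F i) t.
Proof.
rewrite /tlift [RHS]exchange_big; apply: eq_bigr => i _.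
by rewrite [RHS]exchange_big; apply: eq_bigr => j _; rewrite scaler_sumr.
Qed.

Lemma tlift_mull (k : fieldType) (V W : vectType k) (U : algType k)
    (F : V -> W -> U) (a : U) t :
  tlift (fun v w => a * F v w) t = a * tlift F t.
Proof.
rewrite /tlift mulr_sumr; apply: eq_bigr => i _.
by rewrite mulr_sumr; apply: eq_bigr => j _; rewrite scalerAr.
Qed.

Lemma tlift_mulr (k : fieldType) (V W : vectType k) (U : algType k)
    (F : V -> W -> U) (a : U) t :
  tlift (fun v w => F v w * a) t = tlift F t * a.
Proof.
rewrite /tlift mulr_suml; apply: eq_bigr => i _.
by rewrite mulr_suml; apply: eq_bigr => j _; rewrite scalerAl.
Qed.

(** Values are chosen on a basis only; linearity of the relation extends them to all vectors. *)
Lemma lfun_choice (k : fieldType) (V W : vectType k) (R : V -> W -> Prop) :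
    (forall a v v' w w', R v w -> R v' w' -> R (a *: v + v') (a *: w + w')) ->
    (forall v, exists w, R v w) ->
  exists f : 'Hom(V, W), forall v, R v (f v).
Proof.
move=> linR totR.
have R0 : R 0 0.
  by have [w Rw] := totR 0; have := linR (-1) _ _ _ _ Rw Rw;
    rewrite !scaleN1r !addNr.
have /fin_all_exists[w Rw] : forall j : 'I_(\dim {: V}), exists w, R (vbasis {:
  V})`_j w.
  by move=> j; apply: totR.
have [|f fE] := lfun_exists (f :=
  fun v => \sum_j coord (vbasis {: V}) j v *: w j).
  move=> a u v; rewrite scaler_sumr -big_split; apply: eq_bigr => j _.
  by rewrite linearP scalerDl scalerA.
exists f => v; rewrite fE {1}(coord_vbasis (memvf v)).
apply: (big_ind2 R) => [//|v1 w1 v2 w2 R1 R2|j _].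
  by have := linR 1 _ _ _ _ R1 R2; rewrite !scale1r.
by have := linR (coord (vbasis {: V}) j v) _ _ _ _ (Rw j) R0; rewrite !addr0.
Qed.

(** * Coordinate families with values in an extension field *)

Section Separating.
Variables (k : fieldType) (E : fieldExtType k).

(* The coordinates of a vector are E-linear combinations of its values under
   the family c; over E, this says that c spans the dual of E (x) V. *)
Definition separating (V : vectType k) (I : finType) (c : I -> V -> E) :=
  forall f : 'Hom(V, k^o), exists D : I -> E,
    forall v, \sum_i D i * c i v = (f v : k)%:A.

Lemma separating_inj (V : vectType k) (I : finType) (c : I -> V -> E) u v :
  separating c -> (forall i, c i u = c i v) -> u = v.
Proof.
move=> sepc eqc; rewrite (coord_vbasis (memvf u)) (coord_vbasis (memvf v)).
apply: eq_bigr => j _; congr (_ *: _).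
have [|f fE] := lfun_exists (f := coord (vbasis {: V}) j : V -> k^o).
  by move=> a x y; rewrite linearP.
have [D DE] := sepc f; rewrite -!fE; apply: (fmorph_inj (in_alg E)).
by rewrite /= -!DE; apply: eq_bigr => i _; rewrite eqc.
Qed.

(** Each matrix entry of a tensor is a product of two coordinate forms, each an E-combination of the
    given families; a linear form is a combination of the entries. *)
Lemma separating_tens (V W : vectType k) (I J : finType)
    (c : I -> V -> E) (d : J -> W -> E) :
    separating c -> separating d ->
  separating (fun ij : I * J => tlift (fun v w => c ij.1 v * d ij.2 w)).
Proof.
move=> sepc sepd f.
have coordF (U : vectType k) (j : 'I_(\dim {: U})) :
    exists g : 'Hom(U, k^o), g =1 coord (vbasis {: U}) j.
  by apply: lfun_exists => a x y; rewrite linearP.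
have /fin_all_exists[D DE] : forall a : 'I_(\dim {: V}), exists D : I -> E,
    forall v, \sum_i D i * c i v = (coord (vbasis {: V}) a v)%:A.
  move=> a; have [g gE] := coordF V a; have [D DE] := sepc g.
  by exists D => v; rewrite DE gE.
have /fin_all_exists[D' DE'] : forall b : 'I_(\dim {: W}), exists D : J -> E,
    forall w, \sum_i D i * d i w = (coord (vbasis {: W}) b w)%:A.
  move=> b; have [g gE] := coordF W b; have [D' DE'] := sepd g.
  by exists D' => w; rewrite DE' gE.
have entry (t : tens V W) a b : (t a b)%:A =
    \sum_ij D a ij.1 * D' b ij.2 * tlift (fun v w =>
      c ij.1 v * d ij.2 w) t :> E.
  transitivity (tlift (fun v w => (coord (vbasis {: V}) a v)%:A *
      (coord (vbasis {: W}) b w)%:A : E) t).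
    rewrite /tlift (bigD1 a) //= (bigD1 b) //= !coord_free ?(basis_free
      (vbasisP _)) //.
    rewrite !eqxx !scale1r mulr1 big1 ?addr0 => [|j nj]; last first.
      by rewrite coord_free ?(basis_free (vbasisP _)) //
        (negPf nj) scale0r mulr0 scaler0.
    rewrite big1 ?addr0 // => i ni; apply: big1 => j _.
    by rewrite coord_free ?(basis_free (vbasisP _)) //
      (negPf ni) scale0r mul0r scaler0.
  under eq_bigr => ij _ do rewrite -tlift_mull.
  rewrite -tlift_sum; apply: eq_tlift => v w; rewrite -DE -DE' mulr_suml.
  under eq_bigr => i _ do rewrite mulr_sumr.
  rewrite pair_big /=; apply: eq_bigr => ij _.
  by rewrite mulrACA.
exists (fun ij => \sum_a \sum_b ((f (delta_mx a b) : k)%:A * (D a ij.1 * D' b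
  ij.2))).
move=> t; transitivity (\sum_a \sum_b (f (delta_mx a b) : k)%:A * (t a b)%:A :
  E).
  under eq_bigr => ij _ do rewrite mulr_suml.
  rewrite exchange_big; apply: eq_bigr => a _.
  under eq_bigr => ij _ do rewrite mulr_suml.
  rewrite exchange_big; apply: eq_bigr => b _.
  by rewrite entry mulr_sumr; apply: eq_bigr => ij _; rewrite !mulrA.
rewrite [in RHS](matrix_sum_delta t) linear_sum scaler_suml.
apply: eq_bigr => a _; rewrite linear_sum scaler_suml; apply: eq_bigr => b _.
by rewrite linearZ /= mulr_algl scalerA mulrC.
Qed.

End Separating.

(** * Hopf structure on a form of the group algebra E[N] *)

Section HopfDescent.
Variables (k : fieldType) (H : falgType k) (E : fieldExtType k).
Variables (gT : finType) (sg : gT -> 'AEnd(E)).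
Hypothesis sg_fix : forall a, (forall g, sg g a = a) -> exists y : k, a = y%:A.

Variables (nT : finGroupType) (al : gT -> nT -> nT).
Hypothesis al_inj : forall g, injective (al g).
Hypothesis alV : forall g p, al g p^-1%g = (al g p)^-1%g.

Local Notation m := (\dim {: H}).
Local Notation bH := (vbasis {: H}).

(** The value [c p h] is the coefficient at [p] of the image of [h] in E[N], and [D] is the inverse
    of the coefficient matrix. Equivariance places the image of [H] among the elements invariant
    under the Galois action. *)
Variables (c : nT -> H -> E) (D : nT -> 'I_m -> E).
Hypothesis c_lin : forall p, linear (c p).
Hypothesis c_eq : forall g p h, sg g (c p h) = c (al g p) h.
Hypothesis cM : forall r g h,
  c r (g * h) = \sum_q c q g * c (q^-1 * r)%g h.
Hypothesis c1 : forall r, c r 1 = (r == 1%g)%:R.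
Hypothesis DC : forall j h, \sum_p D p j * c p h = (coord bH j h)%:A.
Hypothesis CD : forall p q, \sum_j D p j * c q bH`_j = (p == q)%:R.

Let c_sep : separating c.
Proof.
move=> f; exists (fun p => \sum_j D p j * (f bH`_j : k)%:A) => h.
under eq_bigr => p _ do rewrite mulr_suml.
rewrite exchange_big [in RHS](coord_vbasis (memvf h)) linear_sum scaler_suml.
apply: eq_bigr => j _;
  rewrite linearZ /= -[RHS]/(in_alg E (_ * _)) rmorphM /= -DC mulr_suml.
by apply: eq_bigr => p _; rewrite mulrAC.
Qed.

Let c_inj g h : (forall p, c p g = c p h) -> g = h.
Proof. exact: separating_inj c_sep. Qed.

Let c2 p q : tens H H -> E := tlift (fun g h => c p g * c q h).

Let c2_sep : separating (fun pq => c2 pq.1 pq.2).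
Proof. exact: separating_tens c_sep c_sep. Qed.

Let c2_inj s t : (forall p q, c2 p q s = c2 p q t) -> s = t.
Proof. by move=> eqst; apply: (separating_inj c2_sep) => -[p q];
  apply: eqst. Qed.

Let c3 p q r : tens H (tens H H) -> E := tlift (fun g h => c p g * c2 q r h).

Let c3_inj s t : (forall p q r, c3 p q r s = c3 p q r t) -> s = t.
Proof.
move=> eqst; apply: (separating_inj (separating_tens c_sep c2_sep)).
by case=> p [q r]; apply: eqst.
Qed.

Let mul_lin (A B : vectType k) (f : A -> E) (g : B -> E) :
  linear f -> linear g ->
  (forall w, linear (fun v => f v * g w)) /\ (forall v, linear (fun w =>
    f v * g w)).
Proof.
move=> lf lg; split=> [w|v] a x y /=.
  by rewrite lf mulrDl -scalerAl.
by rewrite lg mulrDr -scalerAr.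
Qed.

Let c2_ptens p q g h : c2 p q (ptens g h) = c p g * c q h.
Proof.
have [bl br] := mul_lin (c_lin p) (c_lin q).
exact: (tlift_ptens bl br).
Qed.

Let c2_lin p q : linear (c2 p q).
Proof. exact: tlift_is_linear. Qed.

Let c3_ptens p q r g t : c3 p q r (ptens g t) = c p g * c2 q r t.
Proof.
have [bl br] := mul_lin (c_lin p) (c2_lin q r).
exact: (tlift_ptens bl br).
Qed.

Let c_tlift (V W : vectType k) p (b : V -> W -> H) t :
  c p (tlift b t) = tlift (fun v w => c p (b v w)) t.
Proof.
have [f fE] := lfun_exists (c_lin p); rewrite -fE linear_tlift.
by apply: eq_tlift => v w; apply: fE.
Qed.

Let sum_eq1 (F : nT -> E) q : \sum_p (p == q)%:R * F p = F q.
Proof.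
rewrite (bigD1 q) //= eqxx mul1r big1 ?addr0 // => p /negPf->.
by rewrite mul0r.
Qed.

Let sum_al (F : nT -> E) g : \sum_p F (al g p) = \sum_p F p.
Proof.
have alP : bijective (al g) := injF_bij (@al_inj g).
by rewrite [RHS](reindex (al g) (onW_bij _ alP)).
Qed.

Let c2_tlift (V W : vectType k) p q (b : V -> W -> tens H H) t :
  c2 p q (tlift b t) = tlift (fun v w => c2 p q (b v w)) t.
Proof. by rewrite /c2 linear_tlift. Qed.

Let c3_tlift (V W : vectType k) p q r (b : V -> W -> tens H (tens H H)) t :
  c3 p q r (tlift b t) = tlift (fun v w => c3 p q r (b v w)) t.
Proof. by rewrite /c3 linear_tlift. Qed.

(** Applying [g] to the coefficient matrix permutes the group index by [al g]; its inverse is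
    permuted in the same way. *)
Let D_eq g p i : sg g (D p i) = D (al g p) i.
Proof.
transitivity (\sum_q (q == p)%:R * D (al g q) i); last first.
  exact: (sum_eq1 (fun q => D (al g q) i)).
transitivity (\sum_j sg g (D p j) * \sum_q D (al g q) i * c (al g q) bH`_j).
  have ij j := sum_al (fun q => D q i * c q bH`_j) g.
  rewrite (bigD1 i) //= ij DC coord_free ?(basis_free (vbasisP _)) //.
  rewrite eqxx scale1r mulr1 big1 ?addr0 // => j nj; rewrite ij DC.
  by rewrite coord_free ?(basis_free (vbasisP _)) // (negPf nj) scale0r mulr0.
under eq_bigr => j _ do rewrite mulr_sumr.
rewrite exchange_big /=; apply: eq_bigr => q _.
rewrite -(rmorph_nat (sg g)) eq_sym -CD rmorph_sum /= mulr_suml;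
  apply: eq_bigr => j _.
by rewrite rmorphM /= c_eq mulrCA mulrC.
Qed.

(** This is the coproduct sending each group element p to p (x) p. Its coordinates in the basis of
    [H] are Galois invariant, hence lie in [k]. *)
Let comul_ex : exists f : 'Hom(H, tens H H),
  forall h p q, c2 p q (f h) = (p == q)%:R * c p h.
Proof.
apply: (lfun_choice (R :=
  fun h t => forall p q, c2 p q t = (p == q)%:R * c p h)).
  by move=> a v v' w w' R1 R2 p q; rewrite c2_lin R1 R2 c_lin mulrDr scalerAr.
move=> h; have /fin_all_exists[y yE] : forall ij : 'I_m * 'I_m, exists y : k,
    y%:A = \sum_r c r h * (D r ij.1 * D r ij.2).
  case=> i j; have [g | y yE] := sg_fix (a := \sum_r c r h * (D r i * D r j)).
    rewrite linear_sum /= -[RHS](sum_al _ g); apply: eq_bigr => r _.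
    by rewrite !rmorphM /= c_eq !D_eq.
  by exists y.
exists (\matrix_(i, j) y (i, j)) => p q.
rewrite /c2 /tlift.
under eq_bigr => i _ do under eq_bigr => j _ do
  rewrite mxE -mulr_algl yE mulr_suml.
under eq_bigr => i _ do rewrite exchange_big.
rewrite exchange_big /=.
transitivity (\sum_r (r == p)%:R * ((r == q)%:R * c r h));
  last by rewrite sum_eq1.
apply: eq_bigr => r _; rewrite -!CD mulr_suml; apply: eq_bigr => i _.
rewrite mulr_suml mulr_sumr; apply: eq_bigr => j _.
by rewrite -[LHS]mulrA (mulrACA (D r i)) [LHS]mulrC -[LHS]mulrA.
Qed.

Let counit_ex : exists f : 'Hom(H, k^o),
  forall h, (f h : k)%:A = \sum_p c p h.
Proof.
apply: (lfun_choice (R := fun h (y : k^o) => (y : k)%:A = \sum_p c p h)).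
  move=> a v v' w w' R1 R2; rewrite scalerDl R2 -[a *: w]/(a * w) -scalerA R1.
  by rewrite scaler_sumr -big_split; apply: eq_bigr => p _; rewrite c_lin.
move=> h; have [g | y yE] := sg_fix (a := \sum_p c p h); last by exists y;
  rewrite yE.
rewrite linear_sum /= -[RHS](sum_al _ g).
by apply: eq_bigr => p _; rewrite c_eq.
Qed.

(** Every invariant element of E[N] comes from [H]: its coordinates, computed with [D], are fixed by
    the Galois group. *)
Let c_coord (e : nT -> E) : (forall g p, sg g (e p) = e (al g p)) ->
  exists h, forall p, c p h = e p.
Proof.
move=> e_eq; have /fin_all_exists[y yE] : forall j : 'I_m, exists y : k,
    y%:A = \sum_r e r * D r j.
  move=> j; have [g | y yE] := sg_fix (a := \sum_r e r * D r j).
    rewrite linear_sum /= -[RHS](sum_al _ g); apply: eq_bigr => r _.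
    by rewrite !rmorphM /= e_eq !D_eq.
  by exists y.
exists (\sum_j y j *: bH`_j) => p; have [f fE] := lfun_exists (c_lin p).
rewrite -fE linear_sum; under eq_bigr => j _ do
  rewrite linearZ /= fE -mulr_algl yE mulr_suml.
rewrite exchange_big -[RHS](sum_eq1 e) /=; apply: eq_bigr => r _.
by rewrite -CD mulr_suml; apply: eq_bigr => j _; rewrite -[LHS]mulrA [LHS]mulrC.
Qed.

Let antipode_ex : exists f : 'End(H), forall h p, c p (f h) = c p^-1%g h.
Proof.
apply: (lfun_choice (R := fun h g => forall p, c p g = c p^-1%g h)).
  by move=> a v v' w w' R1 R2 p; rewrite !c_lin R1 R2.
by move=> h; apply: c_coord => g p; rewrite c_eq alV.
Qed.

(** All axioms are checked on coefficients in E[N] and its tensor powers, which determine elements.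
    There the coproduct is diagonal, the counit is the sum of coefficients, and the antipode inverts
    the group index. *)
Lemma hopf_structure_of_coordinates : exists hH : hopf_structure H,
  [/\ cocommutative hH,
      forall h p q, tlift (fun a b => c p a * c q b) (comul hH h) =
                    (p == q)%:R * c p h
    & forall h, (counit hH h : k)%:A = \sum_p c p h].
Proof.
have [Delta DeltaE] := comul_ex; have [eps epsE] := counit_ex.
have [S SE] := antipode_ex.
have in_alg_inj (x y : k) : x%:A = y%:A :> E -> x = y.
  exact: (fmorph_inj (in_alg E)).
have DM g h : Delta (g * h) =
    tlift (fun g1 g2 => tlift (fun h1 h2 => ptens (g1 * h1) (g2 * h2))
                              (Delta h)) (Delta g).
  apply: c2_inj => p q; rewrite DeltaE cM mulr_sumr c2_tlift.
  transitivity (\sum_u \sum_v c2 u v (Delta g) *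
      c2 (u^-1 * p)%g (v^-1 * q)%g (Delta h)).
    (* The diagonal form of [Delta g] kills the terms with [v] different from [u]. *)
    apply: eq_bigr => u _; rewrite (bigD1 u) //= !DeltaE eqxx mul1r.
    rewrite big1 ?addr0 => [|v]; last first.
      by rewrite DeltaE eq_sym => /negPf->; rewrite mul0r mul0r.
    by rewrite (inj_eq (mulgI _)) mulrCA.
  under eq_bigr => u _ do under eq_bigr => v _ do rewrite /c2 -tlift_mulr.
  under eq_bigr => u _ do rewrite -tlift_sum.
  rewrite -tlift_sum; apply: eq_tlift => g1 g2.
  rewrite c2_tlift.
  under eq_bigr => u _ do under eq_bigr => v _ do rewrite -tlift_mull.
  under eq_bigr => u _ do rewrite -tlift_sum.
  rewrite -tlift_sum; apply: eq_tlift => h1 h2; rewrite c2_ptens.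
  rewrite !cM mulr_suml; apply: eq_bigr => u _.
  by rewrite mulr_sumr; apply: eq_bigr => v _; rewrite mulrACA.
have D1 : Delta 1 = ptens 1 1.
  apply: c2_inj => p q; rewrite DeltaE c2_ptens !c1 -!natrM !mulnb.
  by congr (nat_of_bool _)%:R; case: (eqVneq p 1%g) => [->|];
    rewrite ?andbF // andbT eq_sym.
have epsM g h : eps (g * h) = eps g * eps h.
  apply: in_alg_inj; rewrite -[RHS]/(in_alg E (_ * _)) rmorphM /= !epsE.
  under eq_bigr => p _ do rewrite cM.
  rewrite exchange_big mulr_suml; apply: eq_bigr => q _ /=.
  by rewrite -mulr_sumr; congr (_ * _);
    rewrite [RHS](reindex_inj (mulgI q^-1%g)).
have eps1 : eps 1 = 1.
  apply: in_alg_inj; rewrite epsE scale1r (bigD1 1%g) //= c1 eqxx.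
  by rewrite big1 ?addr0 // => p /negPf p1; rewrite c1 p1.
have DA h :
    tlift (fun h1 h2 => tlift (fun h11 h12 => ptens h11 (ptens h12 h2))
                              (Delta h1)) (Delta h) =
    tlift (fun h1 h2 => ptens h1 (Delta h2)) (Delta h).
  apply: c3_inj => p q r; rewrite !c3_tlift.
  transitivity ((p == q)%:R * c2 p r (Delta h)).
    rewrite -tlift_mull; apply: eq_tlift => h1 h2.
    rewrite c3_tlift mulrA -DeltaE /c2 -tlift_mulr; apply: eq_tlift => g1 g2.
    by rewrite c3_ptens c2_ptens mulrA.
  transitivity ((q == r)%:R * c2 p q (Delta h)); last first.
    rewrite -tlift_mull; apply: eq_tlift => h1 h2.
    by rewrite c3_ptens DeltaE mulrCA.
  rewrite !DeltaE !mulrA -!natrM !mulnb; congr ((nat_of_bool _)%:R * _).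
  by case: eqP => [->|]; rewrite ?andbT ?andbF //= ?[RHS]andbF.
have epsZ h (x : E) : eps h *: x = (\sum_p c p h) * x.
  by rewrite -epsE mulr_algl.
have cZ p (y : k) h : c p (y *: h) = y *: c p h.
  by have [f fE] := lfun_exists (c_lin p); rewrite -!fE linearZ.
have el h : tlift (fun h1 h2 => eps h1 *: h2) (Delta h) = h.
  apply: c_inj => p; rewrite c_tlift -[RHS](sum_eq1 (fun _ => c p h) p).
  transitivity (\sum_q c2 q p (Delta h)).
    rewrite /c2 -tlift_sum; apply: eq_tlift => g1 g2.
    by rewrite cZ epsZ mulr_suml.
  apply: eq_bigr => q _; rewrite DeltaE; case: eqP => [->|] //.
  by rewrite !mul0r.
have er h : tlift (fun h1 h2 => eps h2 *: h1) (Delta h) = h.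
  apply: c_inj => p; rewrite c_tlift -[RHS](sum_eq1 (fun _ => c p h) p).
  transitivity (\sum_q c2 p q (Delta h)).
    rewrite /c2 -tlift_sum; apply: eq_tlift => g1 g2.
    by rewrite cZ epsZ mulr_suml; apply: eq_bigr => q _; rewrite mulrC.
  by apply: eq_bigr => q _; rewrite DeltaE eq_sym.
have c_eps h p : c p (eps h)%:A = (p == 1%g)%:R * \sum_q c q h.
  by rewrite cZ c1 epsZ mulrC.
have Sl h : tlift (fun h1 h2 => S h1 * h2) (Delta h) = (eps h)%:A.
  apply: c_inj => p; rewrite c_tlift c_eps.
  transitivity (\sum_u c2 u^-1%g (u^-1 * p)%g (Delta h)).
    rewrite /c2 -tlift_sum; apply: eq_tlift => g1 g2.
    by rewrite cM; apply: eq_bigr => u _; rewrite SE.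
  rewrite [in RHS](reindex_inj invg_inj) mulr_sumr; apply: eq_bigr => u _ /=.
  rewrite DeltaE; congr ((nat_of_bool _)%:R * _).
  by rewrite eq_sym -{2}[u^-1%g]mulg1 (inj_eq (mulgI _)).
have Sr h : tlift (fun h1 h2 => h1 * S h2) (Delta h) = (eps h)%:A.
  apply: c_inj => p; rewrite c_tlift c_eps.
  transitivity (\sum_u c2 u (u^-1 * p)^-1%g (Delta h)).
    rewrite /c2 -tlift_sum; apply: eq_tlift => g1 g2.
    by rewrite cM; apply: eq_bigr => u _; rewrite SE.
  rewrite mulr_sumr; apply: eq_bigr => u _ /=.
  rewrite DeltaE invMg invgK; congr ((nat_of_bool _)%:R * _).
  by rewrite eq_sym -{2}[u]mul1g (inj_eq (mulIg _)) eq_invg1.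
exists (HopfStructure DM D1 epsM eps1 DA el er Sl Sr); split=> // h.
apply: c2_inj => p q; rewrite c2_tlift DeltaE.
transitivity (c2 q p (Delta h)).
  by apply: eq_tlift => g1 g2; rewrite c2_ptens mulrC.
by rewrite DeltaE; case: eqP => [->|/eqP/negPf]; rewrite ?eqxx // eq_sym => ->;
  rewrite !mul0r.
Qed.

End HopfDescent.

(** * Dedekind independence of algebra morphisms *)

Section Dedekind.
Variables (k : fieldType) (L : falgType k) (E : fieldExtType k).
Variables (T : finType) (y : T -> 'AHom(L, E)).
Hypothesis y_inj : injective y.

Lemma ahom_independent_pred (P : pred T) (c : T -> E) :
    (forall s, \sum_(t | P t) c t * y t s = 0) ->
  forall t, P t -> c t = 0.
Proof.
have [n] := ubnP #|P|; elim: n P c => // n IHn P c leP c0 t Pt.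
have le_n : (#|[pred u | P u & u != t]| < n)%N.
  by rewrite (cardD1x Pt) ltnS in leP.
have ct u : P u -> u != t -> c u = 0.
  move=> Pu nut; have : y u != y t by rewrite (inj_eq y_inj).
  rewrite -val_eqE => /lfunPn[a neq_a]; apply/eqP.
  (* The relation at [a * s] minus [y t a] times the relation at [s] no longer involves [t]; the
     factor at [u] is nonzero by the choice of [a]. *)
  have := IHn [pred u | P u & u != t] (fun v => c v * (y v a - y t a)) le_n _ u.
  rewrite /= Pu nut => /(_ _ isT)/eqP;
    rewrite mulf_eq0 subr_eq0 (negPf neq_a) orbF.
  apply=> s; transitivity (\sum_(v | P v) c v * (y v a - y t a) * y v s).
    by rewrite [RHS](bigD1 t) //= subrr mulr0 mul0r add0r.
  transitivity (\sum_(v | P v) c v * y v (a * s) - y t a * \sum_(v | P v) c v *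
    y v s).
    rewrite mulr_sumr -sumrB; apply: eq_bigr => v _.
    by rewrite rmorphM /= mulrBr mulrBl mulrA (mulrC (c v) (y t a)) mulrA.
  by rewrite !c0 mulr0 subrr.
have := c0 1; rewrite (bigD1 t) //= rmorph1 mulr1 big1 ?addr0 // =>
  u /andP[Pu nut].
by rewrite ct ?mul0r.
Qed.

Lemma ahom_independent (c : T -> E) :
  (forall s, \sum_t c t * y t s = 0) -> forall t, c t = 0.
Proof. by move=> c0 t; apply: (ahom_independent_pred c0). Qed.

(** Independence says that the matrix of values on a basis is row free, and a right inverse supplies
    the dual family. *)
Lemma ahom_dual : exists D : T -> 'I_(\dim {: L}) -> E,
  forall t u, \sum_i D t i * y u (vbasis {: L})`_i = (t == u)%:R.
Proof.
pose R : 'M[E]_(#|T|, \dim {: L}) :=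
  \matrix_(a, i) y (enum_val a) (vbasis {: L})`_i.
have /row_freeP[B RB] : row_free R.
  apply: inj_row_free => v vR0; apply/rowP=> a; rewrite [RHS]mxE.
  rewrite -[a]enum_valK.
  apply: (ahom_independent (c := fun t => v 0 (enum_rank t))) => s.
  rewrite (reindex _ (onW_bij _ (enum_val_bij T))) /=.
  have vE (b : 'I_#|T|) : v 0 (enum_rank (enum_val b)) * y (enum_val b) s =
      \sum_i coord (vbasis {: L}) i s *: (v 0 b * R b i).
    rewrite enum_valK [in LHS](coord_vbasis (memvf s)) linear_sum mulr_sumr.
    by apply: eq_bigr => i _; rewrite mxE linearZ /= scalerAr.
  rewrite (eq_bigr _ (fun b _ => vE b)) exchange_big big1 // => i _.
  have := congr1 (fun w : 'rV_(\dim {: L}) => w 0 i) vR0; rewrite !mxE => vRi.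
  by rewrite -scaler_sumr vRi scaler0.
exists (fun t i => B i (enum_rank t)) => t u.
have := congr1 (fun M : 'M_(#|T|) => M (enum_rank u) (enum_rank t)) RB.
rewrite !mxE (inj_eq enum_rank_inj) eq_sym => <-; apply: eq_bigr => i _.
by rewrite mxE enum_rankK mulrC.
Qed.

End Dedekind.

(** * Hopf-Galois structure from a commutative regular group *)

Section Descent.
Variables (k : fieldType) (L : falgType k) (E : fieldExtType k).
Variables (T : finType) (x : T -> 'AHom(L, E)).
Hypothesis x_inj : injective x.
Hypothesis x_mono : forall t, injective (x t).

Variables (gT : finGroupType) (sg : gT -> 'AEnd(E)) (lam : gT -> T -> T).
Hypothesis sgM : forall g h a, sg (g * h)%g a = sg h (sg g a).
Hypothesis sg_inj : injective sg.
Hypothesis sg_fix : forall a, (forall g, sg g a = a) -> exists y : k, a = y%:A.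
Hypothesis sg_x : forall g t s, sg g (x t s) = x (lam g t) s.
Hypothesis lam_trans : forall t u, exists g, lam g t = u.
Hypothesis x_desc : forall t a, (forall g, lam g t = t -> sg g a = a) ->
  exists s, x t s = a.

Variables (nT : finGroupType) (nu : nT -> T -> T) (al : gT -> nT -> nT).
Hypothesis nuM : forall p q t, nu (p * q)%g t = nu q (nu p t).
Hypothesis nu_free : forall t p q, nu p t = nu q t -> p = q.
Hypothesis nu_trans : forall t u, exists p, nu p t = u.
(* The library multiplies 'End(L) in the order opposite to composition, so the
   tautological action of a subalgebra is only a left action when it commutes.
     *)
Hypothesis nuC : forall p q : nT, commute p q.
Hypothesis lam_nu : forall g p t, lam g (nu p t) = nu (al g p) (lam g t).
Hypothesis cardT : #|T| = \dim {: L}.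

Local Notation n := (\dim {: L}).
Local Notation bL := (vbasis {: L}).

Let y t p := x (nu p t).
Let y_inj t : injective (y t).
Proof. by move=> p q /x_inj/nu_free. Qed.

Let nu1 t : nu 1%g t = t.
Proof.
by have [p pt] := nu_trans t t; have := nuM p 1%g t; rewrite mulg1 pt.
Qed.

Let lam_inj g : injective (lam g).
Proof.
move=> t u eqtu; apply/x_inj/val_inj/lfunP => s; apply: (fmorph_inj (sg g)).
by rewrite /= !sg_x eqtu.
Qed.

Let al_inj g : injective (al g).
Proof.
move=> p q eqpq; have /card_gt0P[t _] : (0 < #|T|)%N by rewrite cardT adim_gt0.
by apply: (@nu_free t); apply: (@lam_inj g); rewrite !lam_nu eqpq.
Qed.

Let lamM g h t : lam (g * h)%g t = lam h (lam g t).
Proof.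
apply/x_inj/val_inj/lfunP => s.
by rewrite /= -!sg_x sgM.
Qed.

Section Coefficients.
Variable t0 : T.

Let alM g p q : al g (p * q)%g = (al g p * al g q)%g.
Proof.
by apply: (@nu_free (lam g t0)); rewrite nuM -!lam_nu nuM.
Qed.

Let al1 g : al g 1%g = 1%g.
Proof. by apply: (@mulgI _ (al g 1%g)); rewrite -alM !mulg1. Qed.

Let alV g p : al g p^-1%g = (al g p)^-1%g.
Proof. by apply: (@mulgI _ (al g p)); rewrite -alM !mulgV al1. Qed.

Let al_mul g h p : al (g * h)%g p = al h (al g p).
Proof.
by apply: (@nu_free (lam (g * h)%g t0)); rewrite -lam_nu !lamM -!lam_nu.
Qed.

Let al_id p : al 1%g p = p.
Proof. by apply: (@al_inj 1%g); rewrite -al_mul mulg1. Qed.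

Variable D0 : nT -> 'I_n -> E.
Hypothesis D0E : forall p q, \sum_i D0 p i * x (nu q t0) bL`_i = (p == q)%:R.

Let sum_eqp (F : nT -> E) p : \sum_q (p == q)%:R * F q = F p.
Proof.
rewrite (bigD1 p) //= eqxx mul1r big1 ?addr0 // => q;
  rewrite eq_sym => /negPf->.
by rewrite mul0r.
Qed.

(* cf phi p is the coefficient of x (nu p t0) in the composite x t0 \o phi. *)
Let cf (phi : 'End(L)) p : E := \sum_i D0 p i * x t0 (phi bL`_i).

Let cf_lin p : linear (cf^~ p).
Proof.
move=> a f g; rewrite /cf scaler_sumr -big_split; apply: eq_bigr => i _ /=.
by rewrite add_lfunE scale_lfunE linearP mulrDr scalerAr.
Qed.

(** The coefficients read off at [t0] are valid at every embedding: [phi] is the action of an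
    element of E[N]. *)
Let good (phi : 'End(L)) :=
  forall t s, x t (phi s) = \sum_p cf phi p * x (nu p t) s.

Let cf_uniq (phi : 'End(L)) (e : nT -> E) :
  (forall s, x t0 (phi s) = \sum_p e p * x (nu p t0) s) -> cf phi =1 e.
Proof.
move=> phiE p; rewrite /cf.
under eq_bigr => i _ do rewrite phiE mulr_sumr.
rewrite exchange_big -[RHS](sum_eqp e) /=; apply: eq_bigr => q _.
by rewrite -D0E mulr_suml; apply: eq_bigr => i _; rewrite mulrCA mulrC.
Qed.

Let good_intro (phi : 'End(L)) (e : nT -> E) :
  (forall t s, x t (phi s) = \sum_p e p * x (nu p t) s) ->
  good phi /\ cf phi =1 e.
Proof.
move=> phiE; have cfE : cf phi =1 e by apply: cf_uniq.
by split=> // t s; rewrite phiE; apply: eq_bigr => p _; rewrite cfE.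
Qed.

Let good_inj phi psi : good phi -> good psi -> cf phi =1 cf psi -> phi = psi.
Proof.
move=> gphi gpsi eqc; apply/lfunP => s; apply: (@x_mono t0).
by rewrite gphi gpsi; apply: eq_bigr => p _; rewrite eqc.
Qed.

(** Applying [g] to the expansion at [t0] yields an expansion at [lam g t0]; Dedekind independence
    identifies its coefficients with those of [good]. *)
Let cf_eq phi g p : good phi -> sg g (cf phi p) = cf phi (al g p).
Proof.
move=> gphi.
have alP : bijective (al g) := injF_bij (@al_inj g).
apply/eqP; rewrite -subr_eq0; apply/eqP.
pose c q := sg g (cf phi q) - cf phi (al g q).
have nu_inj' : injective (fun q => x (nu (al g q) (lam g t0))).
  by move=> q r /x_inj/nu_free/al_inj.
apply: (ahom_independent (c := c) nu_inj') => s.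
rewrite /c; under eq_bigr => q _ do rewrite mulrBl.
rewrite sumrB -(reindex (al g) (onW_bij _ alP) (P := xpredT)
  (F := fun q => cf phi q * x (nu q (lam g t0)) s)) /= -gphi -sg_x gphi.
rewrite linear_sum -sumrB big1 // => q _.
by rewrite /= rmorphM /= sg_x lam_nu subrr.
Qed.

(** By equivariance, the stabiliser of [t0] fixes the combination with coefficients [e], so its
    values lie in the image of [x t0] and define [phi]. Transitivity carries the formula to the
    other embeddings. *)
Let nt_coef (e : nT -> E) : (forall g p, sg g (e p) = e (al g p)) ->
  exists phi, good phi /\ cf phi =1 e.
Proof.
move=> e_eq; have [||phi phiE] := lfun_choice
  (R := fun s s' : L => x t0 s' = \sum_p e p * x (nu p t0) s).
- move=> a v v' w w' /= R1 R2; rewrite linearP /= R1 R2 scaler_sumr -big_split.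
  by apply: eq_bigr => p _; rewrite linearP mulrDr scalerAr.
- move=> s; have [g gt0 | s' <-] := x_desc (t := t0)
    (a := \sum_p e p * x (nu p t0) s); last by exists s'.
  have alP : bijective (al g) := injF_bij (@al_inj g).
  rewrite linear_sum [RHS](reindex (al g) (onW_bij _ alP)) /=.
  by apply: eq_bigr => p _; rewrite rmorphM /= e_eq sg_x lam_nu gt0.
exists phi; apply: good_intro => t s; have [g <-] := lam_trans t0 t.
have alP : bijective (al g) := injF_bij (@al_inj g).
rewrite -sg_x phiE linear_sum [RHS](reindex (al g) (onW_bij _ alP)) /=.
by apply: eq_bigr => p _; rewrite rmorphM /= e_eq sg_x lam_nu.
Qed.

Let good_id : good \1%VF /\ cf \1%VF =1 fun p => (p == 1%g)%:R.
Proof.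
apply: good_intro => t s; rewrite id_lfunE.
rewrite (bigD1 1%g) //= eqxx mul1r nu1 big1 ?addr0 // => p /negPf->.
by rewrite mul0r.
Qed.

Let good_comp phi psi : good phi -> good psi ->
  good (psi \o phi)%VF /\
  cf (psi \o phi)%VF =1 fun r => \sum_q cf phi q * cf psi (q^-1 * r)%g.
Proof.
move=> gphi gpsi; apply: good_intro => t s; rewrite comp_lfunE gpsi.
transitivity (\sum_p \sum_q cf psi p * (cf phi q * x (nu (q * p)%g t) s)).
  apply: eq_bigr => p _; rewrite gphi mulr_sumr; apply: eq_bigr => q _.
  by rewrite (nuC q p) nuM.
rewrite exchange_big; under [RHS]eq_bigr => r _ do rewrite mulr_suml.
rewrite [RHS]exchange_big; apply: eq_bigr => q _ /=.
rewrite [RHS](reindex_inj (mulgI q)); apply: eq_bigr => p _ /=.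
by rewrite mulKg mulrCA mulrA.
Qed.

Import FalgLfun.

(** The condition [good] is linear in [phi] and need only be tested on a basis, so it cuts out an
    intersection of kernels; this subspace is closed under composition. *)
Let A_ex : exists A : {aspace 'End(L)}, forall phi, phi \in A <-> good phi.
Proof.
have /fin_all_exists[F FE] : forall ti : T * 'I_n, exists F : 'Hom('End(L), E),
    forall phi, F phi =
      x ti.1 (phi bL`_(ti.2)) - \sum_p cf phi p * x (nu p ti.1) bL`_(ti.2).
  case=> t i; apply: lfun_exists => a f g /=.
  rewrite add_lfunE scale_lfunE linearP.
  under [X in _ - X = _]eq_bigr => p _ do rewrite cf_lin mulrDl -scalerAl.
  by rewrite big_split /= -scaler_sumr scalerBr opprD addrACA.
pose A := (\bigcap_ti lker (F ti))%VS.
have AP (phi : 'End(L)) : phi \in A <-> forall ti, F ti phi = 0.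
  rewrite memvE; split=> [/subv_bigcapP AF ti | AF].
    by apply/eqP; rewrite -memv_ker memvE AF.
  by apply/subv_bigcapP => ti _; rewrite -memvE memv_ker AF.
have AE (phi : 'End(L)) : phi \in A <-> good phi.
  split=> [/AP Aphi t s | gphi]; last first.
    by apply/AP => ti; rewrite FE gphi subrr.
  have xE (i : 'I_n) : x t (phi bL`_i) = \sum_p cf phi p * x (nu p t) bL`_i.
    by apply/eqP; rewrite -subr_eq0 -(FE (t, i)) Aphi.
  rewrite (coord_vbasis (memvf s)) !linear_sum.
  under [RHS]eq_bigr => p _ do rewrite linear_sum mulr_sumr.
  rewrite [RHS]exchange_big; apply: eq_bigr => i _ /=.
  rewrite !linearZ /= xE scaler_sumr; apply: eq_bigr => p _.
  by rewrite linearZ scalerAr.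
have aA : is_aspace A.
  apply/andP; split.
    by apply: has_algid1; apply/AE; have [] := good_id.
  apply/prodvP => phi psi /AE gphi /AE gpsi; apply/AE.
  by have [] := good_comp gphi gpsi.
by exists (ASpace aA).
Qed.

(** If the trace vanished on a basis of E, the automorphisms would satisfy a nontrivial linear
    relation, against Dedekind. *)
Let trace_neq0 (b : E) : b != 0 -> exists a, \sum_g sg g (a * b) != 0.
Proof.
move=> b0; have [D DE] := ahom_dual sg_inj.
suff [i tr_i] : exists i : 'I_(\dim {: E}), \sum_g sg g (vbasis {: E})`_i != 0.
  by exists ((vbasis {: E})`_i / b); under eq_bigr do rewrite divfK //.
apply/existsP; apply: contraT; rewrite negb_exists => /forallP tr0.
have : (\sum_(g : gT) (1%g == g)%:R : E) = 0.
  transitivity (\sum_i D 1%g i * \sum_g sg g (vbasis {: E})`_i).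
    under [RHS]eq_bigr => i _ do rewrite mulr_sumr.
    by rewrite [RHS]exchange_big /=; apply: eq_bigr => g _; rewrite DE.
  by apply: big1 => i _; have /negPn/eqP-> := tr0 i; rewrite mulr0.
rewrite (bigD1 1%g) //= eqxx big1 ?addr0 => [/eqP|g];
  last by rewrite eq_sym => /negPf->.
by rewrite oner_eq0.
Qed.

Section Coordinates.
Variable A : {aspace 'End(L)}.
Hypothesis AE : forall phi, phi \in A <-> good phi.

Local Notation H := (subvs_of A).
Local Notation m := (\dim {: H}).
Local Notation bH := (vbasis {: H}).

Let c p (h : H) := cf (vsval h) p.

Let c_good (h : H) : good (vsval h).
Proof. by apply/AE/subvsP. Qed.

Let c_lin p : linear (c p).
Proof. by move=> a g h; rewrite /c linearP cf_lin. Qed.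

Let c_inj g h : (forall p, c p g = c p h) -> g = h.
Proof. by move=> eqc; apply/val_inj/good_inj;
  [apply: c_good | apply: c_good | apply: eqc]. Qed.

Let c_eq g p h : sg g (c p h) = c (al g p) h.
Proof. exact/cf_eq/c_good. Qed.

Let valM (g h : H) : vsval (g * h) = (vsval h \o vsval g)%VF.
Proof. by rewrite lfun_compE. Qed.

Let cM r (g h : H) : c r (g * h) = \sum_q c q g * c (q^-1 * r)%g h.
Proof.
have [_ cE] := good_comp (c_good g) (c_good h).
by rewrite /c valM; exact: cE.
Qed.

Let c1 r : c r 1 = (r == 1%g)%:R.
Proof.
have [g1 <-] := good_id; congr (cf _ _).
by apply/eqP; rewrite /= algid_eq1; apply/AE.
Qed.

(* Averaging a relation over gT gives a nontrivial relation with coefficients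
   in k. *)
Let c_free (e : 'I_m -> E) :
  (forall p, \sum_j e j * c p bH`_j = 0) -> forall j, e j = 0.
Proof.
move=> e0 j0; apply/eqP; apply: contraT => /trace_neq0[a /negP[]]; apply/eqP.
have /fin_all_exists[z zE] : forall j, exists z : k, \sum_g sg g (a * e j) =
  z%:A.
  move=> j; apply: sg_fix => g; rewrite linear_sum.
  rewrite [RHS](reindex_inj (mulIg g)); apply: eq_bigr => h _ /=.
  by rewrite sgM.
rewrite zE; suff -> : z j0 = 0 by rewrite scale0r.
have hz0 : \sum_j z j *: bH`_j = 0.
  apply: c_inj => p; have [f fE] := lfun_exists (c_lin p).
  rewrite -!fE linear0 linear_sum.
  transitivity (\sum_j \sum_g sg g (a * e j) * c p bH`_j).
    by apply: eq_bigr => j _; rewrite linearZ /= fE -mulr_algl -zE mulr_suml.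
  rewrite exchange_big big1 // => g _ /=.
  transitivity (sg g (a * \sum_j e j * c (al g^-1%g p) bH`_j)); last first.
    by rewrite e0 mulr0 linear0.
  rewrite mulr_sumr linear_sum; apply: eq_bigr => j _ /=.
  by rewrite mulrA [in RHS]rmorphM /= c_eq -al_mul mulVg al_id.
have := congr1 (coord bH j0) hz0.
by rewrite coord_sum_free ?(basis_free (vbasisP _)) // linear0.
Qed.

(** For each basis vector of E, the trace over the Galois group of that vector times [p] is an
    invariant element of E[N], so it comes from [H]. The dual family of the automorphisms then
    isolates the identity term, which is [p] itself. *)
Let c_span : exists D : nT -> 'I_m -> E,
  forall p q, \sum_j D p j * c q bH`_j = (p == q)%:R.
Proof.
suff /fin_all_exists[D DE] : forall p, exists d : 'I_m -> E,
    forall q, \sum_j d j * c q bH`_j = (p == q)%:R by exists D.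
move=> p; have [d dE] := ahom_dual sg_inj.
pose bE := vbasis {: E}.
have /fin_all_exists[h hE] : forall i : 'I_(\dim {: E}), exists h : H,
    forall q, c q h = \sum_g sg g bE`_i * (al g p == q)%:R.
  move=> i; have [g q | phi [/AE Aphi phiE]] := nt_coef
      (e := fun q => \sum_g sg g bE`_i * (al g p == q)%:R).
    rewrite linear_sum [RHS](reindex_inj (mulIg g)); apply: eq_bigr => h _ /=.
    by rewrite rmorphM /= rmorph_nat sgM al_mul (inj_eq (@al_inj g)).
  by exists (Subvs Aphi).
exists (fun j => \sum_i d 1%g i * (coord bH j (h i))%:A) => q.
transitivity (\sum_i d 1%g i * c q (h i)).
  under eq_bigr => j _ do rewrite mulr_suml.
  rewrite exchange_big; apply: eq_bigr => i _ /=;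
    have [f fE] := lfun_exists (c_lin q).
  rewrite -fE [in RHS](coord_vbasis (memvf (h i))) linear_sum mulr_sumr.
  by apply: eq_bigr => j _; rewrite linearZ /= fE -mulrA mulr_algl.
under eq_bigr => i _ do rewrite hE mulr_sumr.
rewrite exchange_big (bigD1 1%g) //= al_id [X in _ + X]big1 ?addr0 =>
  [|g /negPf g1].
  under eq_bigr => i _ do rewrite mulrA.
  by rewrite -mulr_suml dE eqxx mul1r.
under eq_bigr => i _ do rewrite mulrA.
by rewrite -mulr_suml dE eq_sym g1 mul0r.
Qed.

Section DualBasis.
Variable D : nT -> 'I_m -> E.
Hypothesis CD : forall p q, \sum_j D p j * c q bH`_j = (p == q)%:R.

(** The one-sided inverse [D] is two-sided: the difference of the two sides is a relation among the
    rows of the coefficient matrix, which [c_free] excludes. *)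
Let DCb (i j : 'I_m) : \sum_p D p j * c p bH`_i = (i == j)%:R.
Proof.
apply/eqP; rewrite -subr_eq0; apply/eqP; move: j.
apply: c_free => q; under eq_bigr => j _ do rewrite mulrBl mulr_suml.
rewrite sumrB exchange_big /=.
have -> : \sum_(j < m) (i == j)%:R * c q bH`_j = c q bH`_i.
  rewrite (bigD1 i) //= eqxx mul1r big1 ?addr0 // => j;
    rewrite eq_sym => /negPf->.
  by rewrite mul0r.
apply/eqP; rewrite subr_eq0; apply/eqP.
rewrite -[RHS](sum_eqp (fun p => c p bH`_i)); apply: eq_bigr => p _.
rewrite eq_sym -CD mulr_suml; apply: eq_bigr => j _.
by rewrite mulrAC.
Qed.

Let DC j h : \sum_p D p j * c p h = (coord bH j h)%:A.
Proof.
transitivity (\sum_i coord bH i h *: \sum_p D p j * c p bH`_i).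
  under [RHS]eq_bigr => i _ do rewrite scaler_sumr.
  rewrite [RHS]exchange_big; apply: eq_bigr => p _ /=;
    have [f fE] := lfun_exists (c_lin p).
  rewrite -fE [in LHS](coord_vbasis (memvf h)) linear_sum mulr_sumr.
  by apply: eq_bigr => i _; rewrite linearZ /= fE scalerAr.
rewrite (bigD1 j) //= DCb eqxx big1 ?addr0 // => i /negPf nij.
by rewrite DCb nij scaler0.
Qed.

Let dimH : m = n.
Proof.
have cardN : #|nT| = n.
  rewrite -cardT -(card_imset _ (f := nu^~ t0)) => [|p q]; last exact: nu_free.
  apply/eq_card => t; rewrite !inE; apply/imsetP.
  by have [p <-] := nu_trans t0 t; exists p.
rewrite -cardN.
pose CM : 'M[E]_(m, #|nT|) := \matrix_(j, p) c (enum_val p) bH`_j.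
pose DM : 'M[E]_(#|nT|, m) := \matrix_(p, j) D (enum_val p) j.
have CDM : CM *m DM = 1%:M.
  apply/matrixP=> i j; rewrite !mxE -DCb (reindex _ (onW_bij _ (enum_val_bij
    nT))).
  by apply: eq_bigr => p _; rewrite !mxE mulrC.
have DCM : DM *m CM = 1%:M.
  apply/matrixP=> p q; rewrite !mxE -(inj_eq enum_val_inj) -CD.
  by apply: eq_bigr => j _; rewrite !mxE.
apply/eqP; rewrite eqn_leq -{1}(mxrank1 E m) -{2}(mxrank1 E #|nT|) -CDM -DCM.
by rewrite (leq_trans (mxrankM_maxr _ _)) ?rank_leq_row //
  (leq_trans (mxrankM_maxr _ _)) ?rank_leq_row.
Qed.

Let H_comm (g h : H) : g * h = h * g.
Proof.
apply: c_inj => r; rewrite !cM (reindex_inj invg_inj) (reindex_inj (mulIg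
  r^-1%g)) /=.
apply: eq_bigr => q _.
by rewrite mulrC invgK mulgKV invMg invgK (nuC r).
Qed.

Lemma hopf_galois_of_coordinates :
  exists (H : falgType k) (hH : hopf_structure H) (act : 'Hom(H, 'End(L))),
    [/\ cocommutative hH, module_algebra hH act
      & bijective (hopf_galois_map act)].
Proof.
have [hH [cocH comulE counitE]] := hopf_structure_of_coordinates sg_fix al_inj
  alV c_lin c_eq cM c1 DC CD.
have [act actE] : exists act : 'Hom(H, 'End(L)), act =1 vsval.
  by apply: lfun_exists => a g h; rewrite linearP.
have xact t h s : x t (act h s) = \sum_p c p h * x (nu p t) s.
  by rewrite actE c_good.
exists H, hH, act; split=> //.
  split=> [s | g h s | h | h s u]; apply: (@x_mono t0).
  - rewrite xact (bigD1 1%g) //= c1 eqxx mul1r nu1 big1 ?addr0 // =>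
    p /negPf p1.
    by rewrite c1 p1 mul0r.
  - by rewrite H_comm !actE valM comp_lfunE.
  - rewrite xact linearZ /= rmorph1 counitE; apply: eq_bigr => p _.
    by rewrite rmorph1 mulr1.
  rewrite linear_tlift.
  transitivity (\sum_p \sum_q tlift (fun a b => c p a * c q b) (comul hH h) *
      (x (nu p t0) s * x (nu q t0) u)).
    rewrite xact; apply: eq_bigr => p _;
      rewrite (bigD1 p) //= comulE eqxx mul1r.
    rewrite rmorphM big1 ?addr0 // => q; rewrite eq_sym comulE => /negPf->.
    by rewrite !mul0r.
  under eq_bigr => p _ do under eq_bigr => q _ do rewrite -tlift_mulr.
  under eq_bigr => p _ do rewrite -tlift_sum.
  rewrite -tlift_sum; apply: eq_tlift => g g';
    rewrite /= rmorphM /= !xact mulr_suml.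
  apply: eq_bigr => p _; rewrite mulr_sumr; apply: eq_bigr => q _.
  by rewrite mulrACA.
have [F FE] : exists F : 'Hom(tens L H, 'End(L)), F =1 hopf_galois_map act.
  by apply: lfun_exists; apply: tlift_is_linear.
(* A tensor in the kernel gives a relation among the embeddings, killed by Dedekind, then one among
   the basis of [H], killed by [c_free]; finally [x t0] is injective. Bijectivity follows by
   comparing dimensions. *)
have kF : lker F == 0%VS.
  rewrite -subv0; apply/subvP=> t; rewrite memv_ker memv0 FE => /eqP t0F.
  have xt p : \sum_j (\sum_i t i j *: x t0 bL`_i) * c p bH`_j = 0.
    apply: (ahom_independent (c := fun p =>
      \sum_j (\sum_i t i j *: x t0 bL`_i) * c p bH`_j) (@y_inj t0)) => s.
    transitivity (x t0 (hopf_galois_map act t s));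
      last by rewrite t0F lfunE linear0.
    rewrite /hopf_galois_map /tlift sum_lfunE linear_sum.
    under [RHS]eq_bigr => i _ do rewrite sum_lfunE linear_sum.
    rewrite [RHS]exchange_big /=; under eq_bigr => q _ do rewrite mulr_suml.
    rewrite exchange_big /=; apply: eq_bigr => j _.
    under [RHS]eq_bigr => i _ do
      rewrite scale_lfunE linearZ comp_lfunE lfunE /= rmorphM /= xact scalerAl.
    rewrite -mulr_suml mulr_sumr; apply: eq_bigr => q _.
    by rewrite mulrA.
  apply/eqP/matrixP=> i j; rewrite mxE.
  have := c_free xt j.
  have -> : \sum_i t i j *: x t0 bL`_i = x t0 (\sum_i t i j *: bL`_i).
    by rewrite linear_sum; apply: eq_bigr => a _; rewrite linearZ.
  rewrite -[X in _ = X](linear0 (x t0)) => /x_mono/(congr1 (coord bL i)).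
  by rewrite coord_sum_free ?(basis_free (vbasisP _)) // linear0.
have limF : limg F = fullv.
  apply/eqP; rewrite eqEdim subvf /= limg_dim_eq;
    last by rewrite (eqP kF) capv0.
  have -> : \dim {: tens L H} = (n * m)%N.
    by transitivity (dim 'M[k]_(n, m)); [apply: dimvf | ].
  have -> : \dim {: 'End(L)} = (n * n)%N.
    by transitivity (dim L * dim L)%N; [apply: dimvf | rewrite dimvf].
  by rewrite dimH.
exists (F^-1)%VF => [t | f]; first by rewrite -FE lker0_lfunK.
by rewrite -FE limg_lfunVK // limF memvf.
Qed.

End DualBasis.

Lemma hopf_galois_of_subalgebra :
  exists (H : falgType k) (hH : hopf_structure H) (act : 'Hom(H, 'End(L))),
    [/\ cocommutative hH, module_algebra hH act
      & bijective (hopf_galois_map act)].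
Proof. by have [D CD] := c_span; apply: hopf_galois_of_coordinates CD. Qed.

End Coordinates.

Lemma hopf_galois_of_dual :
  exists (H : falgType k) (hH : hopf_structure H) (act : 'Hom(H, 'End(L))),
    [/\ cocommutative hH, module_algebra hH act
      & bijective (hopf_galois_map act)].
Proof. by have [A AE] := A_ex; apply: hopf_galois_of_subalgebra AE. Qed.

End Coefficients.

Lemma hopf_galois_descent :
  exists (H : falgType k) (hH : hopf_structure H) (act : 'Hom(H, 'End(L))),
    [/\ cocommutative hH, module_algebra hH act
      & bijective (hopf_galois_map act)].
Proof.
have /card_gt0P[t0 _] : (0 < #|T|)%N by rewrite cardT adim_gt0.
have [D0 D0E] := ahom_dual (@y_inj t0).
exact: hopf_galois_of_dual D0E.
Qed.

End Descent.

(** * Cosets of Galois groups *)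

Section CosetPoints.
Variables (k : fieldType) (M : splittingFieldType k) (F E : {subfield M}).
Local Notation H := 'Gal(E / F)%G.

Lemma gal1T (g : gal_of E) : g \in 'Gal(E / 1)%g.
Proof. by rewrite gal_kHom ?sub1v // k1AHom. Qed.

(** As a finite type of its own, the set of cosets lets regular subgroups be taken in its full
    permutation group. The coset of [g] stands for the restriction of [g] to [F]. *)
Definition coset_point := {Y : {set gal_of E} | Y \in gal_cosets F E}.
HB.instance Definition _ := Finite.on coset_point.

Lemma point_subproof g : (H :* g)%g \in gal_cosets F E.
Proof. by apply/rcosetsP; exists g => //; apply: gal1T. Qed.

Definition point g : coset_point := exist _ (H :* g)%g (point_subproof g).

Lemma pointP t : exists g, t = point g.
Proof.
case: t => Y EY; have [g _ defY] := rcosetsP EY.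
by exists g; apply: val_inj.
Qed.

Lemma eq_point g h : (point g == point h) = (g * h^-1 \in H)%g.
Proof. by rewrite -val_eqE /= (sameP eqP rcoset_eqP) mem_rcoset. Qed.

Definition shift (t : coset_point) (g : gal_of E) : coset_point :=
  point (repr (val t) * g)%g.

Lemma shift_point g h : shift (point g) h = point (g * h)%g.
Proof.
apply/eqP; rewrite eq_point invMg mulgA mulgK.
by rewrite -mem_rcoset /= mem_repr_rcoset.
Qed.

Lemma shift_is_action : is_action [set: gal_of E] shift.
Proof.
apply: is_total_action => [t|t g h]; have [a ->] := pointP t.
  by rewrite shift_point mulg1.
by rewrite !shift_point mulgA.
Qed.
Canonical shift_action := Action shift_is_action.

Hypotheses (sFE : (F <= E)%VS) (galE : galois 1%AS E).

Lemma card_gal_cosets : #|gal_cosets F E| = \dim F.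
Proof.
have oG : #|'Gal(E / 1)%g| = \dim E by rewrite -(galois_dim galE) dimv1 divn1.
have galF : galois F E by apply: galoisS galE; rewrite sub1v.
have oH : #|H| = (\dim E %/ \dim F)%N by rewrite -(galois_dim galF).
rewrite -[gal_cosets F E]/(rcosets H 'Gal(E / 1)%G) -/(indexg _ _).
rewrite -divgS ?galS ?sub1v // oG oH.
have dvF : (\dim F %| \dim E)%N by apply: field_dimS.
by rewrite divnA // mulKn // adim_gt0.
Qed.

Lemma card_point : #|{: coset_point}| = \dim F.
Proof. by rewrite card_sig -card_gal_cosets. Qed.

Let sg_ex : exists sg : gal_of E -> 'AEnd(subvs_of E),
  forall g a, vsval (sg g a) = g (vsval a).
Proof.
suff /fin_all_exists[sg sgE] : forall g : gal_of E, exists f : 'AEnd(subvs_of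
  E),
    forall a, vsval (f a) = g (vsval a) by exists sg.
move=> g; have [|||f fE] := ahom_exists (f :=
  fun a : subvs_of E => vsproj E (g (vsval a))).
- by move=> a u v /=; rewrite !linearP.
- move=> a b /=; apply: val_inj;
  rewrite /= !vsprojK ?memv_gal ?memvM ?subvsP //.
  by rewrite rmorphM.
- apply: subvs_inj; rewrite /= vsprojK ?memv_gal ?memv_algid //= algid1.
  exact: rmorph1.
by exists f => a; rewrite fE vsprojK // memv_gal // subvsP.
Qed.

(** Two representatives of a coset differ by an element of [H], which fixes [F] pointwise, so they
    restrict to the same embedding. *)
Let x_ex : exists x : coset_point -> 'AHom(subvs_of F, subvs_of E),
  forall g s, vsval (x (point g) s) = g (vsval s).
Proof.
have /fin_all_exists[x xE] : forall t : coset_point,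
    exists x : 'AHom(subvs_of F, subvs_of E),
      forall s, vsval (x s) = repr (val t) (vsval s).
  move=> t; set g := repr _.
  have EF (s : subvs_of F) : vsval s \in E by apply: (subvP sFE); apply: subvsP.
  have [|||f fE] := ahom_exists (f :=
    fun a : subvs_of F => vsproj E (g (vsval a))).
  - by move=> a u v /=; rewrite !linearP.
  - move=> a b /=; apply: val_inj; rewrite /= !vsprojK ?memv_gal ?memvM ?EF //.
    by rewrite rmorphM.
  - apply: subvs_inj; rewrite /= vsprojK ?memv_gal ?(subvP sFE) ?memv_algid //=
    !algid1.
    exact: rmorph1.
  by exists f => a; rewrite fE vsprojK // memv_gal // EF.
exists x => g s; rewrite xE.
have [h Hh ->] : exists2 h, h \in H & repr (val (point g)) = (h * g)%g.
  by have /rcosetP[h] := mem_repr_rcoset H g; exists h.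
rewrite galM ?(subvP sFE) ?subvsP //; congr (g _).
by apply: (fixed_gal sFE Hh); apply: subvsP.
Qed.

Section Embeddings.
Variables (sg : gal_of E -> 'AEnd(subvs_of E)).
Hypothesis sgE : forall g a, vsval (sg g a) = g (vsval a).
Variable x : coset_point -> 'AHom(subvs_of F, subvs_of E).
Hypothesis xE : forall g s, vsval (x (point g) s) = g (vsval s).

Let sgM g h a : sg (g * h)%g a = sg h (sg g a).
Proof. by apply: val_inj; rewrite /= !sgE galM ?subvsP. Qed.

Let sg_inj : injective sg.
Proof.
move=> g h eqgh; apply/eqP/gal_eqP => a Ea.
by rewrite -(vsprojK Ea) -!sgE eqgh.
Qed.

Let sg_fix a : (forall g, sg g a = a) -> exists y : k, a = y%:A.
Proof.
move=> fixa; have : vsval a \in fixedField 'Gal(E / 1)%g.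
  by apply/fixedFieldP => [|g _]; rewrite ?subvsP // -sgE fixa.
have /galois_fixedField-> := galE; case/vlineP=> y ya.
by exists y; apply: val_inj; rewrite /= algid1.
Qed.

Let sg_x g t s : sg g (x t s) = x (shift t g) s.
Proof.
have [h ->] := pointP t; apply: val_inj.
by rewrite /= shift_point sgE !xE galM // (subvP sFE) ?subvsP.
Qed.

Let x_inj : injective x.
Proof.
move=> t u; have [g ->] := pointP t; have [h ->] := pointP u => eqx.
apply/eqP; rewrite eq_point gal_kHom //; apply/kAHomP => a Fa.
have Ea := subvP sFE a Fa.
rewrite galM // -(vsprojK Fa) -xE eqx xE -galM ?vsprojK //.
by rewrite mulgV gal_id.
Qed.

(** Since [E] is normal over the base field, every embedding of [F] into it extends to an
    automorphism. *)
Let x_surj f : exists t, x t = f.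
Proof.
have [f' f'E] : exists f' : 'End(M), f' =1 (fun a => vsval (f (vsproj F a))).
  by apply: lfun_exists => a u v; rewrite !linearP.
have homf : kHom 1 F f'.
  rewrite k1HomE; apply/ahom_inP; split=> [a b Fa Fb|].
    rewrite !f'E; have -> : vsproj F (a * b) = vsproj F a * vsproj F b.
      by apply: val_inj; rewrite /= !vsprojK // memvM.
    by rewrite rmorphM.
  rewrite f'E; have -> : vsproj F 1 = 1.
    by apply: subvs_inj; rewrite /= vsprojK ?mem1v // algid1.
  by rewrite rmorph1 /= algid1.
have nE : normalField 1 E by case/and3P: galE.
have [|g _ f'g] := kHom_to_gal _ nE homf; first by rewrite sub1v.
exists (point g); apply/val_inj/lfunP => s; apply: val_inj.
by rewrite /= xE -f'g ?subvsP // f'E vsvalK.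
Qed.

(** The stabiliser of the point of [g] is the conjugate of [H] by [g]. If it fixes [a], then [H]
    fixes the image of [a] under the inverse of [g], which therefore lies in [F]. *)
Let x_desc t a : (forall g, shift t g = t -> sg g a = a) -> exists s, x t s = a.
Proof.
have [g ->] := pointP t => fixa.
have galF : galois F E by apply: galoisS galE; rewrite sub1v.
have Fb : vsval (sg g^-1%g a) \in F.
  have /galois_fixedField<- := galF.
  apply/fixedFieldP => [|h Hh]; rewrite ?subvsP //.
  have shift_gh : shift (point g) (g^-1 * h * g)%g = point g.
    by apply/eqP; rewrite shift_point eq_point !mulgA mulgV mul1g mulgK.
  have := congr1 (fun b => vsval (sg g^-1%g b)) (fixa _ shift_gh).
  by rewrite /= -sgM mulgK sgM sgE.
exists (vsproj F (vsval (sg g^-1%g a))); apply: val_inj.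
by rewrite /= xE vsprojK // -sgE -sgM mulVg sgE gal_id.
Qed.

Lemma shift_trans t u : exists g, shift t g = u.
Proof.
have [g ->] := pointP t; have [h ->] := pointP u.
by exists (g^-1 * h)%g; rewrite shift_point mulKVg.
Qed.

Lemma shift_regular_aux : hopf_galois (subvs_of F) ->
  exists N : {group {perm coset_point}},
  [/\ forall t u, exists2 p, p \in N & p t = u,
      forall p t, p \in N -> p t = t -> p = 1%g
    & forall g, actperm shift_action g \in 'N(N)%g].
Proof.
case=> HH [hH [act [_ actH act_bij]]].
have [N [N_trans N_free nN]] :=
  regular_subgroup_of_action x_inj x_surj actH act_bij.
exists N; split=> // g; apply: (nN (sg g)) => t a.
by rewrite actpermE sg_x.
Qed.

Lemma hopf_galois_regular_aux (N : {group {perm coset_point}}) :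
    (forall t u, exists2 p, p \in N & p t = u) ->
    (forall p t, p \in N -> p t = t -> p = 1%g) ->
    abelian N -> (forall g, actperm shift_action g \in 'N(N)%g) ->
  hopf_galois (subvs_of F).
Proof.
move=> N_trans N_free abN nN.
pose nu (p : subg_of N) t := sgval p t.
pose al g (p : subg_of N) := subg N (sgval p ^ actperm shift_action g)%g.
apply: (@hopf_galois_descent k (subvs_of F) (subvs_of E) _ x x_inj _
  (gal_of E) sg (fun g t => shift t g) sgM sg_inj sg_fix sg_x _ _
  (subg_of N) nu al).
- by move=> t a b; apply: fmorph_inj.
- exact: shift_trans.
- by move=> t a; apply: x_desc.
- by move=> p q t; rewrite /nu morphM ?inE // permM.
- move=> t p q eqpq; apply: subg_inj; apply: (semiregular_inj N_free _ _ eqpq);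
  apply: subgP.
- by move=> t u; have [p Np <-] := N_trans t u; exists (subg N p);
  rewrite /nu subgK.
- move=> p q; apply: subg_inj; rewrite !morphM ?inE //.
  by apply: (centsP abN); apply: subgP.
- move=> g p t; rewrite /nu /al subgK ?memJ_norm ?subgP //.
  by rewrite -[shift t g](actpermE shift_action) permJ actpermE.
by rewrite card_point dimvf.
Qed.

End Embeddings.

Lemma shift_regular : hopf_galois (subvs_of F) ->
  exists N : {group {perm coset_point}},
  [/\ forall t u, exists2 p, p \in N & p t = u,
      forall p t, p \in N -> p t = t -> p = 1%g
    & forall g, actperm shift_action g \in 'N(N)%g].
Proof.
by have [[sg sgE] [x xE]] := (sg_ex, x_ex); apply: (shift_regular_aux sgE xE).
Qed.

Lemma hopf_galois_regular (N : {group {perm coset_point}}) :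
    (forall t u, exists2 p, p \in N & p t = u) ->
    (forall p t, p \in N -> p t = t -> p = 1%g) ->
    abelian N -> (forall g, actperm shift_action g \in 'N(N)%g) ->
  hopf_galois (subvs_of F).
Proof.
by have [[sg sgE] [x xE]] := (sg_ex, x_ex);
  apply: (hopf_galois_regular_aux sgE xE).
Qed.

End CosetPoints.

Local Close Scope ring_scope.
Local Open Scope group_scope.

(** * Almost classically Galois extensions and normal complements *)

Section Closure.
Variables (k : fieldType) (M : splittingFieldType k).
Implicit Types (K F E : {subfield M}).

Lemma galois_closureS K F E :
  galois_closure K E -> (K <= F <= E)%VS -> galois_closure F E.
Proof.
case=> sKE galE minE /andP[sKF sFE]; split=> // E' sFE'.
by apply: minE; apply: subv_trans sFE'.
Qed.

Lemma galois_closure_uniq F E E' :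
  galois_closure F E -> galois_closure F E' -> E = E'.
Proof.
case=> sFE galE minE [sFE' galE' minE']; apply/val_inj/eqP.
by rewrite eqEsubv /= minE // minE'.
Qed.

(** The fixed field of [C] is Galois over the base field and contains [F], so by minimality it
    contains [E]. *)
Lemma normal_in_gal_trivial F E (C : {group gal_of E}) :
  galois_closure F E -> C <| 'Gal(E / 1) -> C \subset 'Gal(E / F) -> C :=: 1.
Proof.
case=> sFE galE minE nC sCF.
have galC := normal_fixedField_galois galE nC.
have sEC : (E <= fixedField C)%VS.
  apply: (minE (fixedField_aspace C)) => //.
  by rewrite -galois_connection.
apply/trivgP; rewrite -(gal_fixedField C); apply/subsetP=> g.
rewrite gal_kHom ?capvSl // => /kAHomP gC; rewrite inE; apply/gal_eqP => a Ea.
by rewrite gC ?(subvP sEC) // gal_id.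
Qed.

Section Complement.
Variables (F E : {subfield M}).
Hypothesis clF : galois_closure F E.
Local Notation H := 'Gal(E / F)%G.
Local Notation G := ('Gal(E / 1))%G.

Let sFE : (F <= E)%VS. Proof. by case: clF. Qed.
Let galE : galois 1%AS E. Proof. by case: clF. Qed.

Lemma gal_lambda_on g : perm_on (gal_cosets F E) (gal_lambda F g).
Proof. exact: restr_perm_on. Qed.

Lemma gal_lambda_fix g Y : Y \notin gal_cosets F E -> gal_lambda F g Y = Y.
Proof. exact: out_perm (gal_lambda_on g). Qed.

Lemma gal_cosets_closed (g : gal_of E) Y : Y \in gal_cosets F E -> (Y :* g) \in
  gal_cosets F E.
Proof.
case/rcosetsP=> a _ ->; rewrite -rcosetM.
by apply/rcosetsP; exists (a * g); rewrite ?gal1T.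
Qed.

Lemma gal_lambdaM : {in G &, {morph @gal_lambda k M F E : g h / (g * h)}}.
Proof.
move=> g h _ _; apply/permP=> Y; rewrite permM.
have [EY | nEY] := boolP (Y \in gal_cosets F E);
  last by rewrite !gal_lambda_fix.
by rewrite !gal_lambdaE ?gal1T ?gal_cosets_closed // rcosetM.
Qed.
Canonical gal_lambda_morphism := Morphism gal_lambdaM.

Lemma gal_lambdaJ (g h : gal_of E) :
  gal_lambda F (g ^ h) = gal_lambda F g ^ gal_lambda F h.
Proof. by have := morphJ gal_lambda_morphism (gal1T g) (gal1T h). Qed.

Let lambdaE : gal_lambda_morphism @* G = gal_lambda F @: G.
Proof. by rewrite morphimEdom. Qed.

Lemma gal_lambda_ker : 'ker gal_lambda_morphism = 1.
Proof.
apply: normal_in_gal_trivial clF (ker_normal _) _; apply/subsetP=> g /mker lg.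
have HH : H :* 1 \in gal_cosets F E by apply/rcosetsP; exists 1; rewrite ?gal1T.
have := congr1 (fun p : {perm _} => p (H :* 1)) lg.
rewrite perm1 gal_lambdaE ?gal1T // -rcosetM mul1g rcoset1 => eqH.
by rewrite -[g](mul1g) -eqH mem_rcoset mulgK.
Qed.

Lemma complement_acg (N : {group gal_of E}) :
    N <| G -> (forall g, exists2 n, n \in N & (g * n^-1) \in H) ->
    H :&: N = 1 ->
  almost_classically_galois F.
Proof.
move=> nNG HN tiHN; exists E => //.
exists (gal_lambda_morphism @* N)%G => /=.
have mN n : n \in N -> gal_lambda F n \in gal_lambda_morphism @* N.
  by move=> Nn; apply: mem_morphim; rewrite ?gal1T.
split.
- by move=> _ /morphimP[n _ Nn ->]; apply: gal_lambda_on.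
- move=> _ _ /rcosetsP[a _ ->] /rcosetsP[b _ ->].
  have nN g : g \in 'N(N) by apply: (subsetP (normal_norm nNG)); apply: gal1T.
  (* Since [H :* n] is [H :* (b * a^-1)], the conjugate [n ^ a] carries [H :* a] to [H :* b]. *)
  have [n Nn Hn] := HN (b * a^-1); pose q := n ^ a.
  have Nq : q \in N by rewrite memJ_norm.
  have Ha : H :* a \in gal_cosets F E by apply/rcosetsP; exists a;
    rewrite ?gal1T.
  have qE : gal_lambda F q (H :* a) = H :* b.
    rewrite gal_lambdaE ?gal1T // -rcosetM -conjgC; apply/esym/rcoset_eqP.
    by rewrite mem_rcoset invMg mulgA.
  exists (gal_lambda F q); split=> [|_ [/morphimP[m _ Nm ->] /=]].
    by split; first exact: mN.
  rewrite -qE !gal_lambdaE ?gal1T // -!rcosetM => /rcoset_eqP.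
  rewrite mem_rcoset invMg => Hm; congr (gal_lambda F _); apply/eqP.
  rewrite eq_sym eq_mulgV1 -(conjg_eq1 _ a^-1) -in_set1 -set1gE -tiHN inE;
    apply/andP; split.
    by rewrite conjgE invgK !mulgA; rewrite !mulgA in Hm.
  by rewrite memJ_norm ?groupM ?groupV // nN.
- by rewrite -lambdaE morphim_norms // normal_norm.
by rewrite -lambdaE morphimS ?normal_sub.
Qed.

(** The complement is the preimage of the regular subgroup under [gal_lambda], which is faithful. It
    has as many elements as there are cosets, and it meets the stabiliser [H] of the base coset
    trivially. *)
Lemma acg_complement : almost_classically_galois F ->
  exists N : {group gal_of E},
    [/\ N <| G, #|N| = \dim F & H :&: N = 1].
Proof.
case=> E' clF'; rewrite (galois_closure_uniq clF' clF) => -[N [onN regN nN sN]].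
pose N0 := (gal_lambda_morphism @*^-1 N)%G.
have imN0 : gal_lambda_morphism @* N0 = N by rewrite morphpreK // lambdaE.
have injl : 'injm gal_lambda_morphism by rewrite gal_lambda_ker.
have sN0 : N0 \subset G by apply/subsetP=> g _; apply: gal1T.
have HH : H :* 1 \in gal_cosets F E by apply/rcosetsP; exists 1; rewrite ?gal1T.
exists N0; split.
- rewrite /normal sN0; apply/subsetP=> g Gg; rewrite inE.
  apply/subsetP=> _ /imsetP[h /morphpreP[_ Nh] ->]; apply/morphpreP.
  split; rewrite ?gal1T //= gal_lambdaJ memJ_norm //.
  by apply: (subsetP nN); apply: imset_f.
- rewrite -(card_injm injl sN0) imN0 -(card_gal_cosets sFE galE).
  rewrite -(card_in_imset (f :=
    fun n : {perm _} => n (H :* 1))) => [|p q Np Nq eqpq].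
    apply/eq_card => Y; apply/imsetP/idP => [[p Np ->] | HY].
      by rewrite (perm_closed _ (onN p Np)).
    by have [p [[Np pY] _]] := regN _ _ HH HY; exists p.
  have Hq : q (H :* 1) \in gal_cosets F E by rewrite (perm_closed _ (onN q Nq)).
  have [r [_ rU]] := regN _ _ HH Hq.
  by rewrite -(rU p) ?(rU q).
apply/trivgP/subsetP=> h /setIP[Hh /morphpreP[_ Nh]].
have lh1 : gal_lambda F h (H :* 1) = H :* 1.
  by rewrite gal_lambdaE ?gal1T // rcoset1 rcoset_id.
have [n [_ nU]] := regN _ _ HH HH.
have eq1 : gal_lambda F h = 1.
  by rewrite -(nU _ (conj Nh lh1)); apply: nU; rewrite group1 perm1.
by rewrite -gal_lambda_ker; apply/kerP; rewrite ?gal1T.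
Qed.

End Complement.
End Closure.

(** * Extensions with group F36_2 *)

Section F36_2_extension.
Variables (k : fieldType) (M : splittingFieldType k) (K Kt : {subfield M}).
Hypothesis clK : galois_closure K Kt.

Local Notation G := ('Gal(Kt / 1))%G.

(** The numbering [f] of the cosets turns translation into the morphism [phi]. Its kernel is a
    normal subgroup inside the stabiliser of the base coset, hence trivial. *)
Lemma F36_2_representation :
    perm_similar (gal_cosets K Kt) (gal_lambda K @: G) F36_2 ->
  exists (phi : {morphism G >-> 'S_6}) (i0 : 'I_6),
    [/\ 'injm phi, phi @* G = F36_2,
        forall g, (g \in 'Gal(Kt / K)) = (phi g i0 == i0)
      & forall g x y, x \in gal_cosets K Kt -> y \in gal_cosets K Kt -> x != y
        ->
          gal_lambda K g = tperm x y -> exists i j, i != j /\ phi g = tperm i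
            j].
Proof.
case=> f [f_inj imf fE].
have f_coset i : f i \in gal_cosets K Kt by rewrite -imf imset_f.
have lam_f g i : gal_lambda K g (f i) = f i :* g by rewrite gal_lambdaE ?gal1T.
have ex_perm (g : gal_of Kt) : exists s : 'S_6, forall i, f (s i) = f i :* g.
  have /fin_all_exists[s sE] : forall i, exists j, f j = f i :* g.
    move=> i; have := gal_cosets_closed g (f_coset i); rewrite -imf.
    by case/imsetP=> j _ ->; exists j.
  have s_inj : injective s.
    move=> i j eqij; apply: f_inj; apply: (can_inj (rcosetK g)).
    by rewrite /= -!sE eqij.
  by exists (perm s_inj) => i; rewrite permE sE.
have [phi phiE] := fin_all_exists ex_perm.
have phiM : {in G &, {morph phi : g h / g * h}}.
  move=> g h _ _; apply/permP=> i; apply: f_inj.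
  by rewrite permM !phiE rcosetM.
have HH : 'Gal(Kt / K) :* 1 \in gal_cosets K Kt.
  by apply/rcosetsP; exists 1; rewrite ?gal1T.
have [i0 _ i0E] : exists2 i, i \in setT & 'Gal(Kt / K) :* 1 = f i.
  by apply/imsetP; rewrite imf.
have phi_stab g : (g \in 'Gal(Kt / K)) = (phi g i0 == i0).
  rewrite -(inj_eq f_inj) phiE -i0E rcoset1.
  by apply/idP/eqP=> [/rcoset_id | <-] //; apply: rcoset_refl.
exists (Morphism phiM), i0; split=> //.
- apply/trivgP; apply: (normal_in_gal_trivial clK (ker_normal _)).
  by apply/subsetP=> g /mker /= phig; rewrite phi_stab phig perm1.
- apply/setP=> s; apply/morphimP/idP=> [[g _ _ ->] | /fE[a /imsetP[g _ ->] fs]].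
    apply/fE; exists (gal_lambda K g); first by rewrite imset_f ?gal1T.
    by move=> i; rewrite lam_f phiE.
  exists g; rewrite ?gal1T //=; apply/permP=> i; apply: f_inj.
  by rewrite phiE -lam_f fs.
move=> g x y; rewrite -imf => /imsetP[i _ ->] /imsetP[j _ ->] nij lg.
exists i, j; split; first by apply: contraNneq nij => ->.
apply/permP=> z; apply: (f_inj).
by rewrite /= phiE -lam_f lg (inj_tperm _ _ _ f_inj).
Qed.

Variables (phi : {morphism G >-> 'S_6}) (i0 : 'I_6).
Hypothesis phi_inj : 'injm phi.
Hypothesis phi_im : phi @* G = F36_2.
Hypothesis phi_stab : forall g, (g \in 'Gal(Kt / K)) = (phi g i0 == i0).

Let galKt : galois 1%AS Kt. Proof. by case: clK. Qed.

Let sub_G (A : {set gal_of Kt}) : A \subset G.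
Proof. by apply/subsetP=> g _; apply: gal1T. Qed.

Let phiM g h : phi (g * h) = phi g * phi h.
Proof. by rewrite morphM ?gal1T. Qed.

Let phiV g : phi g^-1 = (phi g)^-1.
Proof. by rewrite morphV ?gal1T. Qed.

Let phiJ g h : phi (g ^ h) = phi g ^ phi h.
Proof. by rewrite !conjgE !phiM phiV. Qed.

Let phiX g n : phi (g ^+ n) = phi g ^+ n.
Proof. by rewrite morphX ?gal1T. Qed.

Let phi_eq g h : phi g = phi h -> g = h.
Proof. by move/(injmP phi_inj); apply; apply: gal1T. Qed.

Let phi_mem (A : {set gal_of Kt}) g : (phi g \in phi @* A) = (g \in A).
Proof.
apply/idP/idP=> [/morphimP[h _ Ah /phi_eq->] // | Ag].
by rewrite mem_morphim ?gal1T.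
Qed.

Let phi_F36_2 g : phi g \in F36_2.
Proof. by rewrite -phi_im mem_morphim ?gal1T. Qed.

Let phi_ex s : s \in F36_2 -> exists g, phi g = s.
Proof. by rewrite -phi_im => /morphimP[g _ _ ->]; exists g. Qed.

Let cardG : #|G| = 72.
Proof. by rewrite -(card_injm phi_inj) ?subxx // phi_im card_F36_2. Qed.

Section Intermediate.
Variable F : {subfield M}.
Hypothesis sKFKt : (K <= F <= Kt)%VS.
Local Notation H := 'Gal(Kt / F)%G.

Let sFKt : (F <= Kt)%VS. Proof. by case/andP: sKFKt. Qed.

Let clF : galois_closure F Kt. Proof. exact: galois_closureS clK sKFKt. Qed.

Lemma card_gal_F36_2 : (#|H| * \dim F)%N = 72.
Proof.
have galF : galois F Kt by apply: galoisS galKt; rewrite sub1v.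
rewrite -cardG -(galois_dim galF) -(galois_dim galKt) dimv1 divn1.
by rewrite divnK // field_dimS.
Qed.

Let phiH_fix s : s \in phi @* H -> s i0 = i0.
Proof.
case/morphimP=> g _ Hg ->; apply/eqP; rewrite -phi_stab.
by apply: (subsetP (galS _ _) g Hg); case/andP: sKFKt.
Qed.

(** A Galois element [g] fixes the coset of [h] exactly when [g ^ h^-1] lies in [H]. So the elements
    supplied by [F36_2_order3] act on the cosets as [no_regular_subgroup] requires, and [N] has
    [\dim F] elements. *)
Lemma hopf_galois_F36_2 : 3 %| #|H| -> hopf_galois (subvs_of F) -> 9 %| \dim F.
Proof.
move=> dv3 /(shift_regular sFKt galKt)[N [N_trans N_free nN]].
have [||a [b [c [[Sa Sb Sc] [a3 b3 cab ac bc] ab [x Sx ax] [y Sy yb]]]]] :=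
  F36_2_order3 (H := phi @* H) (i := i0) _ phiH_fix.
- by rewrite -phi_im morphimS.
- by rewrite card_injm.
have [[a' a'E] [b' b'E]] := (phi_ex Sa, phi_ex Sb).
have [[c' c'E] [x' x'E]] := (phi_ex Sc, phi_ex Sx).
have [y' y'E] := phi_ex Sy.
pose lam := actperm (shift_action F Kt).
have lamM g h : lam (g * h) = lam g * lam h by rewrite /lam actpermM ?inE.
have lamV g : lam g^-1 = (lam g)^-1 by rewrite /lam morphV ?inE.
have lam1 : lam 1 = 1 by rewrite /lam morph1.
have lam_fix g h : (lam g (point F h) == point F h) = (phi g ^ (phi h)^-1 \in
  phi @* H).
  by rewrite actpermE /= shift_point eq_point -phiV -phiJ phi_mem conjgE invgK
    mulgA.
have cardN : #|N| = \dim F.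
  rewrite -(card_point sFKt galKt) -(card_in_imset (f :=
    fun n : {perm _} => n (point F 1))).
    apply/eq_card=> t; rewrite [RHS]inE; apply/imsetP.
    by have [n Nn <-] := N_trans (point F 1) t; exists n.
  by move=> p q Np Nq; apply: (semiregular_inj N_free Np Nq).
rewrite -cardN.
apply: (no_regular_subgroup N_trans N_free (nN a') (nN b') (nN c')
  (t1 := point F x'^-1) (t2 := point F y'^-1)).
- change (lam a' ^+ 3 = 1); rewrite !expgS expg0 mulg1 -!lamM -lam1;
  congr (lam _).
  by apply: phi_eq; rewrite !phiM a'E morph1 -a3 !expgS expg0 mulg1.
- change (lam b' ^+ 3 = 1); rewrite !expgS expg0 mulg1 -!lamM -lam1;
  congr (lam _).
  by apply: phi_eq; rewrite !phiM b'E morph1 -b3 !expgS expg0 mulg1.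
- change (lam a' * lam b' = lam b' * lam a'); rewrite -!lamM; congr (lam _).
  by apply: phi_eq; rewrite !phiM a'E b'E.
- change (lam a' ^ lam c' = (lam a')^-1).
  rewrite conjgE -!lamV -!lamM; congr (lam _).
  by apply: phi_eq; rewrite !phiM !phiV a'E c'E -conjgE.
- change (lam b' ^ lam c' = lam b').
  rewrite conjgE -!lamV -!lamM; congr (lam _).
  by apply: phi_eq; rewrite !phiM !phiV b'E c'E -conjgE.
- move=> t; have [h ->] := pointP t; rewrite !lam_fix a'E b'E ab //.
  by rewrite groupV.
- by apply/eqP; rewrite lam_fix phiV invgK a'E x'E.
by apply/eqP; rewrite lam_fix phiV invgK b'E y'E.
Qed.

Lemma not_acg_F36_2 : \dim F = 18 -> ~ almost_classically_galois F.
Proof.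
move=> dimF /(acg_complement clF)[N [nN oN tiHN]].
have oH : #|H| = 4.
  by apply/eqP; rewrite -(eqn_pmul2r (_ : 0 < 18)) // -{1}dimF card_gal_F36_2.
have ne : (phi @* H) :&: (phi @* N) != 1.
  apply: (F36_2_no_complement (i := i0)); last by rewrite card_injm.
  - by rewrite -phi_im morphim_normal.
  - by rewrite card_injm ?oN.
  - by rewrite -phi_im morphimS.
  exact: phiH_fix.
by rewrite -injmI // tiHN morphim1 eqxx in ne.
Qed.

(** The generator of [H] is odd, so the elements with even image under [phi] form a normal
    complement of [H]. *)
Lemma transposition_acg g i j :
    H :=: <[g]> -> i != j -> phi g = tperm i j ->
  \dim F = 36 /\ almost_classically_galois F.
Proof.
move=> defH nij phig.
have g2 : g ^+ 2 = 1.
  by apply: phi_eq; rewrite phiX phig expgS expg1 tperm2 morph1.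
have g1 : g != 1.
  apply: contraNneq nij => g1; have := congr1 (fun s : 'S_6 => s i) phig.
  by rewrite g1 morph1 perm1 tpermL => ->.
have oH : #|H| = 2 by rewrite defH -orderE; apply: nt_prime_order.
split.
  by apply/eqP; rewrite -(eqn_pmul2l (_ : 0 < 2)) // -{1}oH card_gal_F36_2.
have evenG : group_set [set h | ~~ odd_perm (phi h)].
  apply/group_setP; split=> [|h h'];
    rewrite !inE ?morph1 ?odd_perm1 // phiM odd_permM.
  by move=> /negPf-> /negPf->.
apply: (complement_acg clF (N := Group evenG)).
- rewrite /normal sub_G; apply/subsetP=> h _; rewrite inE; apply/subsetP.
  by move=> _ /imsetP[h' + ->]; rewrite !inE phiJ odd_permJ.
- move=> h; have [oddh | evenh] := boolP (odd_perm (phi h)); last first.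
    by exists h; rewrite ?inE // mulgV group1.
  exists (g^-1 * h); last by rewrite invMg invgK mulgA mulgV mul1g defH
    cycle_id.
  by rewrite inE phiM phiV odd_permM odd_permV phig odd_tperm nij oddh.
apply: prime_TIg; first by rewrite oH.
by rewrite defH cycle_subG inE phig odd_tperm nij.
Qed.

(** The regular group is the product of the normal subgroup [V] of order 9, acting by translation,
    and an involution of the cosets that commutes with all translations. It is abelian, has at most
    18 elements and is transitive on 18 points. *)
Lemma hopf_galois_F36_2_18 : \dim F = 18 -> hopf_galois (subvs_of F).
Proof.
move=> dimF.
have oH : #|H| = 4.
  by apply/eqP; rewrite -(eqn_pmul2r (_ : 0 < 18)) // -{1}dimF card_gal_F36_2.
have [W nW oW] := F36_2_normal9.
pose V := (phi @*^-1 W)%G.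
have imV : phi @* V = W by rewrite morphpreK // phi_im normal_sub.
have oV : #|V| = 9 by rewrite -(card_injm phi_inj (sub_G V)) imV.
have nV g : g \in 'N(V).
  rewrite inE; apply/subsetP=> _ /imsetP[h Vh ->].
  rewrite -phi_mem imV phiJ memJ_norm -?imV ?phi_mem //.
  by rewrite imV (subsetP (normal_norm nW)).
have pH : 2.-group H by rewrite /pgroup oH.
(* The Sylow subgroup [D] has order 8 and contains [H] with index 2, so any [d] in [D] outside [H]
   normalises [H] and has its square in [H]. *)
have [D sylD sHD] := Sylow_superset (sub_G H) pH.
have oD : #|D| = 8 by rewrite (card_Hall sylD) cardG p_part.
have iHD : #|D : H| = 2 by rewrite -divgS // oD oH.
have nHD := index2_normal sHD iHD.
have [d Dd Hd] : exists2 d, d \in D & d \notin H.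
  by apply/subsetPn; apply/negP => /subset_leq_card; rewrite oD oH.
have nHd : d \in 'N(H) by apply: (subsetP (normal_norm nHD)).
have defHd : H :* d = D :\: H by apply: rcoset_index2 => //; rewrite inE Hd.
have d2 : d * d \in H.
  apply: contraT => nHdd;
    have : d * d \in H :* d by rewrite defHd inE nHdd groupM.
  by rewrite mem_rcoset mulgK (negPf Hd).
have DV g : exists2 h, h \in D & h^-1 * g \in V.
  have tiDV : D :&: V = 1 by apply: coprime_TIg; rewrite oD oV.
  have : g \in D * V.
    have -> : D * V = G.
      by apply/eqP; rewrite eqEcard sub_G TI_cardMg // oD oV cardG.
    exact: gal1T.
  by case/mulsgP=> h v Dh Vv ->; exists h; rewrite ?mulKg.
(* Multiplication by [d] on the side of [H] is well defined on cosets because [d] normalises [H]. *)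
pose sigma (t : coset_point F Kt) := point F (d * repr (val t)).
have sigmaE g : sigma (point F g) = point F (d * g).
  apply/eqP; rewrite eq_point invMg.
  have /rcosetP[h Hh ->] := mem_repr_rcoset H g.
  by rewrite !mulgA mulgK -mulgA -{1}[d]invgK -conjgE memJ_norm ?groupV.
have sigmaK : involutive sigma.
  move=> t; have [g ->] := pointP t; apply/eqP.
  by rewrite !sigmaE eq_point !mulgA mulgK.
pose sp := perm (inv_inj sigmaK).
have spE g : sp (point F g) = point F (d * g) by rewrite permE sigmaE.
pose lam := actperm (shift_action F Kt).
have lamE g h : lam g (point F h) = point F (h * g).
  by rewrite actpermE /= shift_point.
have sp2 : sp ^+ 2 = 1.
  by apply/permP=> t; rewrite expgS expg1 permM perm1 !permE sigmaK.
have lam_sp g : commute (lam g) sp.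
  apply/permP=> t; have [h ->] := pointP t.
  by rewrite !permM spE !lamE spE mulgA.
have abV : abelian V by apply: (@card_p2group_abelian _ 3).
pose lV := (lam @* V)%G.
have lVmem v : v \in V -> lam v \in lV by move=> Vv; apply: mem_morphim Vv;
  rewrite in_setT.
have cspV : <[sp]> \subset 'C(lV).
  rewrite cycle_subG; apply/centP => _ /morphimP[v _ _ ->].
  exact/commute_sym/lam_sp.
pose N := (lV <*> <[sp]>)%G.
have defN : N = lV * <[sp]> :> {set _} by apply: cent_joinEr.
have oN : #|N| <= 18.
  have le_lV : #|lV| <= 9 by rewrite -oV leq_morphim.
  have le_sp : #|<[sp]>| <= 2 by rewrite -orderE dvdn_leq // order_dvdn sp2.
  apply: leq_trans (leq_mul le_lV le_sp).
  by rewrite defN mul_cardG leq_pmulr // cardG_gt0.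
(* Write [g] as [h * v] with [h] in [D] and [v] in [V]. The coset of [g] is that of [v] when [h] is
   in [H], and that of [d * v] otherwise. *)
have N_trans1 u : exists2 p, p \in N & p (point F 1) = u.
  have [g ->] := pointP u; have [h Dh Vhg] := DV g.
  have [Hh | nHh] := boolP (h \in H).
    exists (lam (h^-1 * g)); first by rewrite /= mem_gen // inE lVmem.
    by apply/eqP; rewrite lamE mul1g eq_point mulgK groupV.
  have : h \in H :* d by rewrite defHd inE nHh.
  rewrite mem_rcoset => Hhd.
  exists (lam (h^-1 * g) * sp).
    by rewrite groupM // mem_gen // inE ?lVmem ?cycle_id ?orbT.
  apply/eqP; rewrite permM lamE mul1g spE eq_point mulgA mulgK.
  by rewrite -groupV invMg invgK.
have N_trans t u : exists2 p, p \in N & p t = u.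
  have [p Np <-] := N_trans1 t; have [q Nq <-] := N_trans1 u.
  by exists (p^-1 * q); rewrite ?groupM ?groupV // permM permK.
apply: (hopf_galois_regular sFKt galKt N_trans).
- move=> p t Np pt.
  (* A transitive group with no more elements than points acts freely. *)
  have /imset_injP inj_t : #|(fun n : {perm _} => n t) @: N| == #|N|.
    rewrite eqn_leq leq_imset_card (leq_trans oN) //.
    rewrite -dimF -(card_point sFKt galKt); apply/subset_leq_card/subsetP=> u _.
    by have [q Nq <-] := N_trans t u; apply: imset_f.
  by apply: inj_t => //; rewrite perm1.
- by rewrite /= defN abelianM morphim_abelian // cycle_abelian.
move=> g; rewrite -sub1set normsY // sub1set.
  rewrite inE; apply/subsetP=> _ /imsetP[_ /morphimP[v _ Vv ->] ->].
  rewrite -[_ ^ _](morphJ lam (in_setT v) (in_setT g)) lVmem // memJ_norm //.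
by rewrite (subsetP (cent_sub _)) // cent_cycle; apply/cent1P/lam_sp.
Qed.

End Intermediate.

End F36_2_extension.

Theorem proposition4p10 (k : fieldType) (M : splittingFieldType k)
    (K Kt : {subfield M})
    (sepK : separable 1%AS K)
    (dimK : \dim K = 6)
    (clK : galois_closure K Kt)
    (galK : perm_similar (gal_cosets K Kt)
              (gal_lambda K @: ('Gal(Kt / 1))%g) F36_2) :
  [/\ (* (a) *)
      forall F : {subfield M}, (K <= F <= Kt)%VS -> \dim F = 12 ->
        ~ hopf_galois (subvs_of F),
      (* (b) *)
      forall F : {subfield M}, (K <= F <= Kt)%VS -> \dim F = 18 ->
        hopf_galois (subvs_of F) /\ ~ almost_classically_galois F,
      (* (c) *)
      forall F : {subfield M}, (K <= F <= Kt)%VS -> \dim F = 24 ->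
        ~ hopf_galois (subvs_of F)
    & (* (d) *)
      (exists F : {subfield M},
        [/\ (K <= F <= Kt)%VS, \dim F = 36 & almost_classically_galois F]) /\
      (forall F : {subfield M}, (K <= F <= Kt)%VS ->
        (exists g x y, [/\ ('Gal(Kt / F))%g = <[g]>%g,
             x \in gal_cosets K Kt, y \in gal_cosets K Kt, x != y
           & gal_lambda K g = tperm x y]) ->
        \dim F = 36 /\ almost_classically_galois F)].
Proof.
have [phi [i0 [phi_inj phi_im phi_stab phi_tperm]]] :=
  F36_2_representation clK galK.
have card_gal F := card_gal_F36_2 clK phi_inj phi_im (F := F).
have card_gal_dim (F : {subfield M}) d c : (K <= F <= Kt)%VS -> \dim F = d ->
  (c * d = 72)%N ->
    0 < d -> #|'Gal(Kt / F)| = c.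
  move=> KF dimF cd d_gt0; have /eqP := card_gal F KF.
  by rewrite dimF -cd eqn_pmul2r // => /eqP.
have no_hopf F := hopf_galois_F36_2 clK phi_inj phi_im phi_stab (F := F).
split.
(* In degrees 12 and 24 the subgroup fixing [F] has order 6 and 3, divisible by 3, whereas 9 does
   not divide the degree. *)
- move=> F KF dimF /(no_hopf _ KF); rewrite (card_gal_dim _ 12 6) // dimF.
  by move=> /(_ isT).
- move=> F KF dimF; split.
    exact: (hopf_galois_F36_2_18 clK phi_inj phi_im KF).
  exact: (not_acg_F36_2 clK phi_inj phi_im phi_stab KF).
- move=> F KF dimF /(no_hopf _ KF); rewrite (card_gal_dim _ 24 3) // dimF.
  by move=> /(_ isT).
split=> [|F KF [g [x [y [defH Kx Ky nxy lg]]]]]; last first.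
  have [i [j [nij phig]]] := phi_tperm g x y Kx Ky nxy lg.
  exact: (transposition_acg clK phi_inj phi_im KF defH nij phig).
(* A transposition fixing [i0] comes from an element of ['Gal(Kt / K)], so its fixed field contains
   [K]. *)
have [i [j [Sij nij fix_i0]]] := F36_2_transposition i0.
have /morphimP[g _ _ phig] : tperm i j \in phi @* 'Gal(Kt / 1) by rewrite
  phi_im.
have Kg : g \in 'Gal(Kt / K) by rewrite phi_stab -phig fix_i0.
have [sKKt _ _] := clK.
pose F := fixedField_aspace <[g]>.
have KF : (K <= F <= Kt)%VS.
  by rewrite -galois_connection // cycle_subG Kg fixedField_bound.
have [dimF acgF] := transposition_acg clK phi_inj phi_im (F := F) KF
  (gal_fixedField _) nij (esym phig).
by exists F.
Qed.
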